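(* Let $H$ be an abelian group. Then: (1) $H$ is cm-slender if and only if $H$ is torsion-free, reduced (contains no subgroup isomorphic to $\mathbb{Q}$), and contains no subgroup which admits a non-discrete Polish group topology; (2) $H$ is lcH-slender if and only if $H$ is cotorsion-free.
   Context: A group $H$ is cm-slender if every abstract homomorphism from a completely metrizable topological group to $H$ has open kernel; $H$ is lcH-slender if every abstract homomorphism from a locally compact Hausdorff topological group to $H$ has open kernel. A Polish group is a separable completely metrizable topological group. An abelian group is algebraically compact if it is a direct summand of a compact Hausdorff abelian group; it is cotorsion if it is a homomorphic image of an algebraically compact group; it is cotorsion-free if it contains no nontrivial cotorsion subgroup, equivalently if it contains no nontrivial torsion, no copy of $\mathbb{Q}$, and no copy of the $p$-adic integers $J_p$ for any prime $p$. *)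

(* Defs.v *)
From HB Require Import structures.
From mathcomp Require Import all_boot all_algebra.
From Stdlib Require Import Reals.

Set Implicit Arguments.
Unset Strict Implicit.
Unset Printing Implicit Defensive.

Local Open Scope ring_scope.

Record topgroup := TopGroup {
  tg_car :> Type;
  tg_mul : tg_car -> tg_car -> tg_car;
  tg_one : tg_car;
  tg_inv : tg_car -> tg_car;
  tg_open : (tg_car -> Prop) -> Prop;
  tg_mulA : forall x y z, tg_mul x (tg_mul y z) = tg_mul (tg_mul x y) z;
  tg_mul1x : forall x, tg_mul tg_one x = x;
  tg_mulx1 : forall x, tg_mul x tg_one = x;
  tg_mulVx : forall x, tg_mul (tg_inv x) x = tg_one;
  tg_mulxV : forall x, tg_mul x (tg_inv x) = tg_one;
  tg_open_full : tg_open (fun _ => True);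
  tg_open_inter : forall U V, tg_open U -> tg_open V ->
                   tg_open (fun x => U x /\ V x);
  tg_open_union : forall F : (tg_car -> Prop) -> Prop,
                   (forall U, F U -> tg_open U) ->
                   tg_open (fun x => exists U, F U /\ U x);
  tg_mul_cont : forall U, tg_open U -> forall x y, U (tg_mul x y) ->
      exists V W, tg_open V /\ tg_open W /\ V x /\ W y /\
        (forall a b, V a -> W b -> U (tg_mul a b));
  tg_inv_cont : forall U, tg_open U -> tg_open (fun x => U (tg_inv x))
}.

Section TopDefs.
Variable G : topgroup.

Definition tg_commutative : Prop :=
  forall x y : G, tg_mul x y = tg_mul y x.

Definition discrete : Prop := forall U : G -> Prop, tg_open U.

Definition hausdorff : Prop :=
  forall x y : G, x <> y -> exists U V, tg_open U /\ tg_open V /\ U x /\ V y /\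
     (forall z, U z -> V z -> False).

Definition compact (K : G -> Prop) : Prop :=
  forall C : (G -> Prop) -> Prop,
    (forall U, C U -> tg_open U) ->
    (forall x, K x -> exists U, C U /\ U x) ->
    exists l : list (G -> Prop),
      (forall U, List.In U l -> C U) /\
      (forall x, K x -> exists U, List.In U l /\ U x).

Definition locally_compact : Prop :=
  forall x : G, exists (U K : G -> Prop),
    tg_open U /\ U x /\ (forall y, U y -> K y) /\ compact K.

Definition is_metric (d : G -> G -> R) : Prop :=
  (forall x y, Rle 0 (d x y)) /\
  (forall x y, d x y = 0%R <-> x = y) /\
  (forall x y, d x y = d y x) /\
  (forall x y z, Rle (d x z) (d x y + d y z)%R).

Definition metric_induces (d : G -> G -> R) : Prop :=
  forall U : G -> Prop, tg_open U <->
    (forall x, U x -> exists eps, Rlt 0 eps /\ forall y, Rlt (d x y) eps -> U y).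

Definition metric_complete (d : G -> G -> R) : Prop :=
  forall s : nat -> G,
    (forall eps, Rlt 0 eps -> exists N : nat, forall m n : nat, leq N m -> leq N n ->
        Rlt (d (s m) (s n)) eps) ->
    exists l, forall eps, Rlt 0 eps -> exists N : nat, forall n : nat, leq N n ->
        Rlt (d (s n) l) eps.

Definition completely_metrizable : Prop :=
  exists d, is_metric d /\ metric_induces d /\ metric_complete d.

Definition separable : Prop :=
  exists s : nat -> G, forall U, tg_open U -> (exists x, U x) -> exists n, U (s n).

Definition polish : Prop := completely_metrizable /\ separable.

End TopDefs.

Definition ghom (G : topgroup) (H : zmodType) (f : G -> H) : Prop :=
  forall x y : G, f (tg_mul x y) = f x + f y.

Definition cm_slender (H : zmodType) : Prop :=
  forall G : topgroup, completely_metrizable G ->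
    forall f : G -> H, ghom f -> tg_open (fun x : G => f x = 0).

Definition lcH_slender (H : zmodType) : Prop :=
  forall G : topgroup, locally_compact G -> hausdorff G ->
    forall f : G -> H, ghom f -> tg_open (fun x : G => f x = 0).

Definition torsion_free (H : zmodType) : Prop :=
  forall (x : H) (n : nat), leq 1 n -> x *+ n = 0 -> x = 0.

Definition reduced (H : zmodType) : Prop :=
  ~ exists f : rat -> H, (forall a b, f (a + b) = f a + f b) /\ injective f.

(* no subgroup of H admits a non-discrete Polish group topology:
   a subgroup with such a topology is the same as an injective
   homomorphism from a non-discrete Polish group into H *)
Definition no_nondiscrete_polish_subgroup (H : zmodType) : Prop :=
  ~ exists (K : topgroup) (f : K -> H),
      polish K /\ ~ discrete K /\ ghom f /\ injective f.

(* A is algebraically compact: A is (isomorphic to) a direct summand of a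
   compact Hausdorff abelian topological group C, i.e. there are homs
   i : A -> C and r : C -> A with r \o i = id. *)
Definition algebraically_compact (A : zmodType) : Prop :=
  exists (C : topgroup) (i : A -> C) (r : C -> A),
    tg_commutative C /\ compact (fun _ : C => True) /\ hausdorff C /\
    (forall a b, i (a + b) = tg_mul (i a) (i b)) /\ ghom r /\
    (forall a, r (i a) = a).

Definition cotorsion (B : zmodType) : Prop :=
  exists (A : zmodType) (f : A -> B),
    algebraically_compact A /\ (forall a b, f (a + b) = f a + f b) /\
    (forall b, exists a, f a = b).

(* H is cotorsion-free: no nontrivial cotorsion subgroup
   (subgroups are given as injective homomorphisms B -> H) *)
Definition cotorsion_free (H : zmodType) : Prop :=
  forall (B : zmodType) (j : B -> H),
    (forall a b, j (a + b) = j a + j b) -> injective j ->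
    cotorsion B -> forall b : B, b = 0.

(* Main.v *)
(** Let f be a homomorphism whose kernel is not open. Choosing x_n close to 1 with
    f(x_n) <> 0, the system z_n = x_n^(a_n) z_(n+1)^(n+1) can be solved for all digits a_n
    of moderate growth (by completeness, or by compactness along an ultrafilter), so that
    f(z_0) is congruent to \sum_(n < N) n! a_n f(x_n) modulo N! H for all N. If H is
    torsion-free and reduced, its Z-adic topology is Hausdorff and these congruences
    determine f(z_0); hence the formal series \sum n! a_n f(x_n) with a_n = o(n) have values
    in H, and the values form a non-discrete Polish group for the quotient norm.

    In the locally compact case the same device with f(x_n) = h constant extends 1 |-> h to
    the profinite integers, so in a cotorsion-free H no h <> 0 is taken arbitrarily close to
    1. The image of f is then a non-discrete locally compact abelian group, in which one finds
    a nontrivial compact subgroup or a divisible element, both excluded.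

    Conversely, prime torsion or a copy of Q in H yields a homomorphism with non-open kernel
    on a countable power of Z/p or Q, obtained by extending the sum of coordinates. *)

From Stdlib Require Import Reals Lra Lia.
From HB Require Import structures.
From mathcomp Require Import all_boot all_algebra.
From mathcomp Require Import boolp classical_sets filter.
Require Import Defs.

Set Implicit Arguments.
Unset Strict Implicit.
Unset Printing Implicit Defensive.

Import GRing.Theory.

Delimit Scope R_scope with Re.
Local Open Scope ring_scope.

Local Notation "x ** y" := (tg_mul x y) (at level 40, left associativity).

(** * Topological groups *)

(** The digit range shapes the metrizable half. On integer sequences the plain sup norm is discrete;
    with the weight n + 1 the n-th unit sequence has norm at most 1 / (n + 1), so digits up to about
    n must be allowed and the values form a non-discrete group. With only |a_n| = O(n), finitely
    supported sequences would not be dense among the coefficient sequences; o(n) restores this and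
    gives separability. The factors n! separate points: norm below 1 / (N + 1) kills the first N
    integer coefficients and leaves a multiple of N!. One element can have many expansions, hence a
    quotient norm.

    The generators x_n have to be fixed before the digits, so each x_n must serve all the finitely
    many words in the earlier ones at once.

    Factorial digits of a profinite integer satisfy a_n <= n, so the same bound serves the compact
    half. There G may be non-abelian, while the final argument needs commuting elements; the
    topology is therefore transported to H. Cotorsion-freeness enters only through the vanishing of
    all homomorphisms from compact abelian groups to H. *)

Lemma funextP (T : Type) (U V : T -> Prop) : (forall x, U x <-> V x) -> U = V.
Proof. by move=> h; apply: funext => x; apply: propext. Qed.

Section TopGroupBasics.
Variable G : topgroup.
Implicit Types (x y z : G) (U V W : G -> Prop).

Lemma tg_open_local U :
  (forall x, U x -> exists V, tg_open V /\ V x /\ (forall y, V y -> U y)) ->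
  tg_open U.
Proof.
move=> h.
have -> : U = (fun x => exists V, (tg_open V /\ (forall y, V y -> U y)) /\ V x).
  apply: funextP => x; split; last by case=> V [[_ s] /s].
  by move=> /h [V [oV [Vx s]]]; exists V.
by apply: tg_open_union => V [].
Qed.

Lemma tg_open_bigcap (P : nat -> G -> Prop) n :
  (forall i, (i <= n)%N -> tg_open (P i)) ->
  tg_open (fun x => forall i, (i <= n)%N -> P i x).
Proof.
elim: n => [|n IH] h.
  have -> : (fun x => forall i, (i <= 0)%N -> P i x) = P 0%N.
    apply: funextP => x; split=> [|hx i]; first exact.
    by rewrite leqn0 => /eqP ->.
  exact: h.
have -> : (fun x => forall i, (i <= n.+1)%N -> P i x) =
   (fun x => (forall i, (i <= n)%N -> P i x) /\ P n.+1 x).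
  apply: funextP => x; split=> [hx|[hx hn] i]; first
    by split=> [i hi|]; apply: hx => //; apply: leqW.
  by rewrite leq_eqVlt => /orP [/eqP ->|]; [|rewrite ltnS; apply: hx].
by apply: tg_open_inter; [apply: IH => i hi; apply: h; apply: leqW|apply: h].
Qed.

Definition tg_continuous (g : G -> G) : Prop :=
  forall U, tg_open U -> tg_open (fun x => U (g x)).

Lemma tg_continuous_id : tg_continuous id.
Proof. by []. Qed.

Lemma tg_continuous_cst a : tg_continuous (fun=> a).
Proof.
move=> U oU; apply: tg_open_local => x Ua; exists (fun=> True).
by split=> //; exact: tg_open_full.
Qed.

Lemma tg_continuous_mul g h :
  tg_continuous g -> tg_continuous h -> tg_continuous (fun x => g x ** h x).
Proof.
move=> cg ch U oU; apply: tg_open_local => x Ux.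
have [V [W [oV [oW [Vx [Wx s]]]]]] := tg_mul_cont oU Ux.
exists (fun y => V (g y) /\ W (h y)); split; last by split=> // y [? ?]; apply: s.
by apply: tg_open_inter; [apply: cg|apply: ch].
Qed.

Fixpoint tg_pow x n : G := if n is m.+1 then x ** tg_pow x m else tg_one G.

Lemma tg_continuous_pow n : tg_continuous (fun x => tg_pow x n).
Proof.
elim: n => [|n IH]; first exact: tg_continuous_cst.
by apply: tg_continuous_mul.
Qed.

Lemma tg_pow1 n : tg_pow (tg_one G) n = tg_one G.
Proof. by elim: n => //= n ->; rewrite tg_mul1x. Qed.

Lemma tg_powD x m n : tg_pow x (m + n) = tg_pow x m ** tg_pow x n.
Proof. by elim: m => [|m IH]; [rewrite tg_mul1x|rewrite addSn /= IH tg_mulA]. Qed.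

Lemma tg_powM x m n : tg_pow x (m * n) = tg_pow (tg_pow x m) n.
Proof. by elim: n => [|n IH] /=; [rewrite muln0|rewrite mulnS tg_powD IH]. Qed.

Lemma tg_mulI x y z : x ** y = x ** z -> y = z.
Proof. by move=> /(congr1 (tg_mul (tg_inv x))); rewrite !tg_mulA tg_mulVx !tg_mul1x. Qed.

Lemma tg_invK x : tg_inv (tg_inv x) = x.
Proof. by apply: (@tg_mulI (tg_inv x)); rewrite tg_mulxV tg_mulVx. Qed.

Lemma tg_inv1 : tg_inv (tg_one G) = tg_one G.
Proof. by rewrite -[LHS]tg_mul1x tg_mulxV. Qed.

Lemma tg_invM x y : tg_inv (x ** y) = tg_inv y ** tg_inv x.
Proof.
apply: (@tg_mulI (x ** y)); rewrite tg_mulxV tg_mulA -(tg_mulA x) tg_mulxV.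
by rewrite tg_mulx1 tg_mulxV.
Qed.

Lemma tg_open_mulM U : tg_open U -> U (tg_one G) ->
  exists W, [/\ tg_open W, W (tg_one G), (forall x, W x -> W (tg_inv x)) &
    forall x y, W x -> W y -> U (x ** y)].
Proof.
move=> oU U1.
have [|V [W [oV [oW [V1 [W1 s]]]]]] := tg_mul_cont (x := tg_one G) (y := tg_one G) oU.
  by rewrite tg_mul1x.
pose X x := V x /\ W x.
have oX : tg_open X by apply: tg_open_inter.
exists (fun x => X x /\ X (tg_inv x)); split.
- by apply: tg_open_inter => //; apply: tg_inv_cont.
- by rewrite tg_inv1.
- by move=> x [? ?]; rewrite tg_invK.
- by move=> x y [[? ?] _] [[? ?] _]; apply: s.
Qed.

(* Separation from the identity alone gives disjoint neighbourhoods, by translating a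
   symmetric W with W W contained in the separating set. *)
Lemma hausdorff_of_T1 :
  (forall x, x <> tg_one G -> exists U, tg_open U /\ U (tg_one G) /\ ~ U x) ->
  hausdorff G.
Proof.
move=> h x y nxy.
have [|U [oU [U1 nU]]] := h (tg_inv x ** y).
  by move=> e; apply: nxy; rewrite -(tg_mulx1 x) -e tg_mulA tg_mulxV tg_mul1x.
have [W [oW W1 sW WW]] := tg_open_mulM oU U1.
exists (fun z => W (tg_inv x ** z)), (fun z => W (tg_inv y ** z)).
rewrite !tg_mulVx; split; last split; try split=> //.
- exact: (tg_continuous_mul (tg_continuous_cst _) tg_continuous_id).
- exact: (tg_continuous_mul (tg_continuous_cst _) tg_continuous_id).
- split=> // z Wx Wy; apply: nU.
  have := WW _ _ Wx (sW _ Wy).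
  by rewrite tg_invM tg_invK tg_mulA -(tg_mulA _ z) tg_mulxV tg_mulx1.
Qed.

End TopGroupBasics.

Section Hom.
Variables (G : topgroup) (H : zmodType) (f : G -> H).
Hypothesis hf : ghom f.

Lemma ghom1 : f (tg_one G) = 0.
Proof. by apply: (addrI (f (tg_one G))); rewrite -hf tg_mul1x addr0. Qed.

Lemma ghomV x : f (tg_inv x) = - f x.
Proof. by apply: (addrI (f x)); rewrite -hf tg_mulxV ghom1 subrr. Qed.

Lemma ghomX x n : f (tg_pow x n) = f x *+ n.
Proof. by elim: n => [|n IH] /=; [rewrite ghom1 mulr0n|rewrite hf IH mulrS]. Qed.

(** A kernel containing a neighbourhood of 1 is open, by translation. *)
Lemma ghom_ker_not_open W : ~ tg_open (fun x => f x = 0) ->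
  tg_open W -> W (tg_one G) -> exists x, W x /\ f x <> 0.
Proof.
move=> nk oW W1; apply: contrapT => /forallNP h; apply: nk.
have W0 x : W x -> f x = 0 by move=> Wx; apply: contrapT => fx; apply: (h x).
apply: tg_open_local => x fx; exists (fun y => W (tg_inv x ** y)); split.
  exact: (tg_continuous_mul (tg_continuous_cst _) (@tg_continuous_id G)).
rewrite tg_mulVx; split=> // y /W0; by rewrite hf ghomV fx oppr0 add0r.
Qed.

(** Apply [f] to the recursion [N] times: each step multiplies the unknown remainder by one more
    factor, so it ends up divisible by [N!]. Since [H] is abelian, the order of the factors in [G]
    is lost. *)
Lemma factorial_expansion (x z : nat -> G) (a : nat -> nat) :
  (forall n, z n = tg_pow (x n) (a n) ** tg_pow (z n.+1) n.+1) ->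
  forall N, f (z 0%N) = \sum_(n < N) f (x n) *+ a n *+ n`! + f (z N) *+ N`!.
Proof.
move=> hz; elim=> [|N ->]; first by rewrite big_ord0 add0r fact0.
rewrite big_ord_recr /= -addrA; congr (_ + _).
by rewrite {1}hz hf !ghomX mulrnDl factS (mulrnA (f (z N.+1))).
Qed.

End Hom.

(* The finite stages of the recursion z n = x n ^ a n * z n.+1 ^ n.+1. *)
Fixpoint nested_word (G : topgroup) (x : nat -> G) (a : nat -> nat) n j (w : G) : G :=
  if j is i.+1 then
    tg_pow (x n) (a n) ** tg_pow (nested_word x a n.+1 i w) n.+1
  else w.

(** The recursion peels off the outermost letter, but consecutive approximations differ in the
    innermost one; this identity exposes the latter. *)
Lemma nested_word_last (G : topgroup) (x : nat -> G) a n j w :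
  nested_word x a n j.+1 w =
  nested_word x a n j
    (tg_pow (x (n + j)%N) (a (n + j)%N) ** tg_pow w (n + j).+1).
Proof.
elim: j n => [|j IH] n; first by rewrite addn0.
by rewrite [LHS]/= -/(nested_word x a n.+1 j.+1 w) IH addSnnS.
Qed.

(** * Abelian groups packaged from raw operations and as subgroups *)

Section ZmodOf.
Variables (T : Type) (zero : T) (opp : T -> T) (add : T -> T -> T).
Hypotheses (addA : associative add) (addC : commutative add)
  (add0 : left_id zero add) (addN : left_inverse zero opp add).

Let cT : choiceType := HB.pack_for choiceType T (gen_eqMixin T) (gen_choiceMixin T).

Definition mk_zmod : zmodType :=
  HB.pack_for zmodType T cT
    (GRing.isZmodule.Build cT addA addC add0 addN).

End ZmodOf.

Section SubZmod.
Variables (H : zmodType) (S : H -> Prop).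

Definition add_subgroup : Prop :=
  [/\ S 0, (forall x y, S x -> S y -> S (x + y)) & forall x, S x -> S (- x)].

Hypothesis hS : add_subgroup.
Let sT := {x | S x}.
Let S0 : S 0. Proof. by case: hS. Qed.
Let SD x y : S x -> S y -> S (x + y). Proof. by case: hS => _ h _; exact: h. Qed.
Let SN x : S x -> S (- x). Proof. by case: hS => _ _; exact. Qed.

Let sval_inj (u v : sT) : sval u = sval v -> u = v.
Proof. by case: u v => [u pu] [v pv] /= e; subst v; congr exist; exact: Prop_irrelevance. Qed.

Let szero : sT := exist _ 0 S0.
Let sopp (u : sT) : sT := exist _ (- sval u) (SN (svalP u)).
Let sadd (u v : sT) : sT := exist _ (sval u + sval v) (SD (svalP u) (svalP v)).
Let saddA : associative sadd.
Proof. by move=> u v w; apply: sval_inj; exact: addrA. Qed.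
Let saddC : commutative sadd.
Proof. by move=> u v; apply: sval_inj; exact: addrC. Qed.
Let sadd0 : left_id szero sadd.
Proof. by move=> u; apply: sval_inj; exact: add0r. Qed.
Let saddN : left_inverse szero sopp sadd.
Proof. by move=> u; apply: sval_inj; exact: addNr. Qed.

Definition sub_zmod : zmodType := mk_zmod saddA saddC sadd0 saddN.

Implicit Types (u v : sub_zmod).

Definition sub_val u : H := sval u.
Lemma sub_valD u v : sub_val (u + v) = sub_val u + sub_val v. Proof. by []. Qed.
Lemma sub_val0 : sub_val 0 = 0. Proof. by []. Qed.
Lemma sub_val_inj u v : sub_val u = sub_val v -> u = v. Proof. exact: sval_inj. Qed.
Lemma sub_valP u : S (sub_val u). Proof. exact: svalP. Qed.
Lemma sub_val_surj x : S x -> exists u, sub_val u = x.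
Proof. by move=> hx; exists (exist _ x hx). Qed.

End SubZmod.

Definition tg_zmod (G : topgroup) (cG : tg_commutative G) : zmodType :=
  mk_zmod (@tg_mulA G) cG (@tg_mul1x G) (@tg_mulVx G).

(** * Normed groups and countable products *)

Definition group_norm (S : zmodType) (N : S -> R) : Prop :=
  [/\ N 0 = 0%Re, forall x : S, N (- x) = N x,
      forall x y : S, (N (x + y)%R <= N x + N y)%Re & forall x : S, N x = 0%Re -> x = 0].

Section NormTop.
Variables (S : zmodType) (N : S -> R) (hN : group_norm N).
Implicit Types (a b x y z : S) (e : R) (U V W : S -> Prop).

Lemma group_norm_ge0 x : (0 <= N x)%Re.
Proof.
have [N0 NN NT _] := hN.
by have := NT x (- x); rewrite subrr N0 NN; lra.
Qed.

Definition norm_open (U : S -> Prop) : Prop :=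
  forall x, U x -> exists e, (0 < e)%Re /\ forall y, (N (x - y)%R < e)%Re -> U y.

Fact norm_open_inter U V : norm_open U -> norm_open V ->
  norm_open (fun x => U x /\ V x).
Proof.
move=> oU oV x [/oU [e [e0 he]] /oV [e' [e'0 he']]].
exists (Rmin e e'); split=> [|y hy]; first exact: Rmin_pos.
by split; [apply: he|apply: he']; apply: Rlt_le_trans hy _; [apply: Rmin_l|apply: Rmin_r].
Qed.

Fact norm_open_union (F : (S -> Prop) -> Prop) : (forall U, F U -> norm_open U) ->
  norm_open (fun x => exists U, F U /\ U x).
Proof.
move=> oF x [U [FU Ux]]; have [e [e0 he]] := oF _ FU _ Ux.
by exists e; split=> // y hy; exists U; split=> //; apply: he.
Qed.

Lemma norm_open_ball a e : norm_open (fun x => N (a - x)%R < e)%Re.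
Proof.
have [_ _ NT _] := hN.
move=> x hx; exists (e - N (a - x))%Re; split=> [|y hy]; first lra.
have -> : a - y = (a - x) + (x - y) by rewrite addrA subrK.
by have := NT (a - x) (x - y); lra.
Qed.

Fact norm_mul_cont U : norm_open U -> forall x y, U (x + y) ->
  exists V W, norm_open V /\ norm_open W /\ V x /\ W y /\
    (forall a b, V a -> W b -> U (a + b)).
Proof.
have [N0 _ NT _] := hN.
move=> oU x y /oU [e [e0 he]].
exists (fun z => N (x - z)%R < e / 2)%Re, (fun z => N (y - z)%R < e / 2)%Re.
split; first exact: norm_open_ball.
split; first exact: norm_open_ball.
rewrite !subrr N0; split; first lra.
split; first lra.
move=> a b ha hb; apply: he.
have -> : x + y - (a + b) = (x - a) + (y - b) by rewrite opprD addrACA.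
by have := NT (x - a) (y - b); lra.
Qed.

Fact norm_inv_cont U : norm_open U -> norm_open (fun x => U (- x)).
Proof.
have [_ NN _ _] := hN.
move=> oU x /oU [e [e0 he]]; exists e; split=> // y hy; apply: he.
by rewrite -opprD NN.
Qed.

Definition norm_topgroup : topgroup :=
  @TopGroup S +%R 0 -%R norm_open (@addrA S) (@add0r S) (@addr0 S)
    (@addNr S) (@addrN S) (fun _ _ => ex_intro _ 1%Re (conj Rlt_0_1 (fun _ _ => I)))
    norm_open_inter norm_open_union norm_mul_cont norm_inv_cont.

Lemma norm_metric : is_metric (G := norm_topgroup) (fun x y : S => N (x - y)).
Proof.
have [N0 NN NT Ns] := hN.
split=> [x y|]; first exact: group_norm_ge0.
split=> [x y|]; first by split=> [/Ns /subr0_eq|->] //; rewrite subrr.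
split=> [x y|x y z]; first by rewrite -NN opprB.
have -> : x - z = (x - y) + (y - z) by rewrite addrA subrK.
exact: NT.
Qed.

Lemma norm_completely_metrizable :
  metric_complete (G := norm_topgroup) (fun x y : S => N (x - y)) ->
  completely_metrizable norm_topgroup.
Proof.
by exists (fun x y : S => N (x - y)); split; first exact: norm_metric.
Qed.

End NormTop.

Section Product.
Variable T : nat -> zmodType.

Definition dprod : zmodType :=
  @mk_zmod (forall n, T n) (fun n => 0) (fun u n => - u n) (fun u v n => u n + v n)
    (fun u v w => functional_extensionality_dep (fun n => addrA (u n) (v n) (w n)))
    (fun u v => functional_extensionality_dep (fun n => addrC (u n) (v n)))
    (fun u => functional_extensionality_dep (fun n => add0r (u n)))
    (fun u => functional_extensionality_dep (fun n => addNr (u n))).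

Implicit Types u v : dprod.
Definition coord u n : T n := u n.

Lemma coordD u v n : coord (u + v) n = coord u n + coord v n. Proof. by []. Qed.
Lemma coordN u n : coord (- u) n = - coord u n. Proof. by []. Qed.
Lemma coordB u v n : coord (u - v) n = coord u n - coord v n. Proof. by []. Qed.
Lemma coordMn u k n : coord (u *+ k) n = coord u n *+ k.
Proof. by elim: k => [|k IH]; rewrite ?mulr0n // !mulrS coordD IH. Qed.
Lemma coord_inj u v : (forall n, coord u n = coord v n) -> u = v.
Proof. by move=> h; apply: functional_extensionality_dep => n; exact: h. Qed.

(** The usual ultrametric on a product of discrete groups: size is decided by the first nonzero
    coordinate. That index exists only classically, so the norm is first specified and then
    chosen. *)
Lemma dprod_norm_ex : exists N : dprod -> R, forall u,
  (u = 0 /\ N u = 0%Re) \/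
  exists m, [/\ coord u m <> 0, (forall n, (n < m)%N -> coord u n = 0) &
               N u = (/ INR m.+1)%Re].
Proof.
suff /choice [N hN] : forall u, exists r : R, (u = 0 /\ r = 0%Re) \/
    exists m, [/\ coord u m <> 0, (forall n, (n < m)%N -> coord u n = 0) &
               r = (/ INR m.+1)%Re] by exists N.
move=> u.
have [->|nu] := pselect (u = 0); first by exists 0%Re; left.
have ex : exists m, coord u m != 0.
  apply: contrapT => /forallNP h; apply: nu; apply: coord_inj => n.
  by have := h n; move/negP; rewrite negbK => /eqP.
exists (/ INR (ex_minn ex).+1)%Re; right; exists (ex_minn ex).
case: ex_minnP => m /eqP hm hmin; split=> // n hn.
apply/eqP; apply: contraTT hn; rewrite -leqNgt; exact: hmin.
Qed.

Definition dprod_norm : dprod -> R := projT1 (cid dprod_norm_ex).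

Lemma dprod_normP u :
  (u = 0 /\ dprod_norm u = 0%Re) \/
  exists m, [/\ coord u m <> 0, (forall n, (n < m)%N -> coord u n = 0) &
               dprod_norm u = (/ INR m.+1)%Re].
Proof. by rewrite /dprod_norm; case: cid. Qed.

Lemma invINR_gt0 n : (0 < / INR n.+1)%Re.
Proof. by apply/Rinv_0_lt_compat/lt_0_INR/Nat.lt_0_succ. Qed.

Lemma invINR_le m n : (m <= n)%N -> (/ INR n.+1 <= / INR m.+1)%Re.
Proof.
move=> /leP h; apply: Rinv_le_contravar; first exact/lt_0_INR/Nat.lt_0_succ.
by apply: le_INR; lia.
Qed.

Lemma invINR_lt m n : (m < n)%N -> (/ INR n.+1 < / INR m.+1)%Re.
Proof.
move=> /leP h; apply: Rinv_lt_contravar; last by apply: lt_INR; lia.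
by apply: Rmult_lt_0_compat; apply/lt_0_INR/Nat.lt_0_succ.
Qed.

Lemma invINR_small e : (0 < e)%Re -> exists n, (/ INR n.+1 < e)%Re.
Proof.
move=> e0; have [n [hn n0]] := archimed_cor1 e e0.
by case: n hn n0 => [|n] hn n0; [lia|exists n].
Qed.

Lemma dprod_norm_lt u n :
  (dprod_norm u < / INR n.+1)%Re <-> (forall i, (i <= n)%N -> coord u i = 0).
Proof.
have [[-> ->]|[m [hm hlt ->]]] := dprod_normP u.
  by split=> // _; exact: invINR_gt0.
split=> h.
  move=> i hi; apply: hlt; apply: leq_ltn_trans hi _; rewrite ltnNge.
  by apply/negP => /invINR_le; lra.
by apply: invINR_lt; rewrite ltnNge; apply/negP => /h.
Qed.

Lemma dprod_group_norm : group_norm dprod_norm.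
Proof.
have ge0 u : (0 <= dprod_norm u)%Re.
  have [[-> ->]|[m [hm hlt ->]]] := dprod_normP u; first lra.
  by have := invINR_gt0 m; lra.
have low u m : coord u m <> 0 -> (/ INR m.+1 <= dprod_norm u)%Re.
  by move=> h; apply: Rnot_lt_le => /dprod_norm_lt /(_ m (leqnn m)).
have N_le u : (dprod_norm (- u) <= dprod_norm u)%Re.
  have [[_ ->]|[m [hm _ ->]]] := dprod_normP (- u) => //.
  by apply: low => h; apply: hm; rewrite coordN h oppr0.
split.
- have [[_ ->]|[m [hm _ _]]] //:= dprod_normP 0.
- move=> u; apply: Rle_antisym => //.
  by rewrite -{1}(opprK u).
- move=> u v; have [[_ ->]|[m [hm _ ->]]] := dprod_normP (u + v).
    by have := ge0 u; have := ge0 v; lra.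
  have [e|/low] := pselect (coord u m = 0); last by have := ge0 v; lra.
  have /low : coord v m <> 0 by move=> e'; apply: hm; rewrite coordD e e' addr0.
  by have := ge0 u; lra.
- move=> u; have [[]|[m [_ _ ->]]] // := dprod_normP u.
  by have := invINR_gt0 m; lra.
Qed.

Definition dprod_topgroup : topgroup := norm_topgroup dprod_group_norm.

Lemma dprod_openP (U : dprod -> Prop) : tg_open (t := dprod_topgroup) U <->
  forall u, U u -> exists n, forall v, (forall i, (i <= n)%N -> coord v i = coord u i) -> U v.
Proof.
split=> h u Uu.
  have [e [e0 he]] := h _ Uu.
  have [n hn] := invINR_small e0.
  exists n => v hv; apply: he; apply: Rlt_trans hn; apply/dprod_norm_lt => i /hv.
  by rewrite coordB => ->; rewrite subrr.
have [n hn] := h _ Uu; exists (/ INR n.+1)%Re; split; first exact: invINR_gt0.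
move=> v /dprod_norm_lt hv; apply: hn => i /hv; rewrite coordB.
by move/eqP; rewrite subr_eq0 => /eqP.
Qed.

Lemma dprod_open0 (U : dprod -> Prop) : tg_open (t := dprod_topgroup) U -> U 0 ->
  exists n, forall v, (forall i, (i <= n)%N -> coord v i = 0) -> U v.
Proof. by move=> /dprod_openP h /h. Qed.

Lemma dprod_commutative : tg_commutative dprod_topgroup.
Proof. by move=> u v; exact: (@addrC dprod). Qed.

Lemma dprod_completely_metrizable : completely_metrizable dprod_topgroup.
Proof.
apply: norm_completely_metrizable => s cs.
have [g hg] : exists g : nat -> nat, forall n i j, (g n <= i)%N -> (g n <= j)%N ->
    forall k, (k <= n)%N -> coord (s i) k = coord (s j) k.
  suff /choice [g hg] : forall n, exists m, forall i j, (m <= i)%N -> (m <= j)%N ->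
    forall k, (k <= n)%N -> coord (s i) k = coord (s j) k by exists g.
  move=> n.
  have [m hm] := cs _ (invINR_gt0 n).
  exists m => i j hi hj k hk.
  have /dprod_norm_lt /(_ k hk) := hm i j hi hj.
  by rewrite coordB => /eqP; rewrite subr_eq0 => /eqP.
(* Diagonal limit: coordinate [n] is read at a stage [g n] from which it no longer changes. *)
exists (fun n => coord (s (g n)) n : T n) => e e0.
have [n hn] := invINR_small e0.
exists (\max_(i < n.+1) g i)%N => m hm; apply: Rlt_trans hn; apply/dprod_norm_lt => i hi.
rewrite coordB; apply/eqP; rewrite subr_eq0; apply/eqP; apply: (hg i) => //.
apply: leq_trans hm; exact: (leq_bigmax (Ordinal (hi : (i < n.+1)%N))).
Qed.

End Product.

Lemma hausdorff_metrizable (G : topgroup) : completely_metrizable G -> hausdorff G.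
Proof.
case=> d [[d0 [ds [dC dT]]] [di _]] x y nxy.
have dxy : (0 < d x y)%Re.
  by case: (Rle_lt_or_eq_dec _ _ (d0 x y)) => // /esym /ds.
have ob z e : tg_open (fun w => d z w < e)%Re.
  apply/di => w hw; exists (e - d z w)%Re; split; first lra.
  by move=> v hv; have := dT z w v; lra.
exists (fun w => d x w < d x y / 2)%Re, (fun w => d y w < d x y / 2)%Re.
have dd z : d z z = 0%Re by apply/ds.
split=> //; split=> //; rewrite !dd; split; first lra.
split; first lra.
by move=> z; rewrite (dC y); have := dT x z y; lra.
Qed.

(** * Compactness and monothetic groups *)

Section ProductCompact.
Variable T : nat -> zmodType.
Hypothesis finT : forall n, exists l : list (T n), forall t, List.In t l.

(* Koenig: if no finite subfamily covers, some branch of the tree of cylinders is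
   never finitely covered, yet its limit lies in a member of the cover. *)
Lemma dprod_compact : compact (fun _ : dprod_topgroup T => True).
Proof.
move=> C oC cC; apply: contrapT => nfin.
pose agree n (u v : dprod T) := forall i, (i < n)%N -> coord v i = coord u i.
pose bad n (u : dprod T) := ~ exists l, (forall U, List.In U l -> C U) /\
  (forall v, agree n u v -> exists U, List.In U l /\ U v).
have step n u : bad n u -> exists v, agree n u v /\ bad n.+1 v.
  move=> bu; apply: contrapT => /forallNP h; apply: bu.
  (* If no child of the cylinder is bad, prescribing the coordinate [n] to be [t] gives a finitely
     covered set for each [t]; finiteness of [T n] then joins these covers. *)
  have h' t : exists l, (forall U, List.In U l -> C U) /\
      (forall v, agree n u v -> coord v n = t -> exists U, List.In U l /\ U v).
    have := h (dfwith (u : forall n, T n) t : dprod T); move=> /not_andP [nag|].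
      exfalso; apply: nag => i hi; rewrite /coord dfwith_out //; apply/eqP => e.
      by rewrite e ltnn in hi.
    move=> /contrapT [l [lC lc]]; exists l; split=> // v hv e; apply: lc => i.
    rewrite ltnS leq_eqVlt => /orP [/eqP ->|hi]; first by rewrite /coord dfwith_in.
    rewrite hv // /coord dfwith_out //; apply/eqP => e'; by rewrite e' ltnn in hi.
  have [lt hlt] := finT n.
  suff [l [lC lc]] : exists l, (forall U, List.In U l -> C U) /\
      (forall v, agree n u v -> List.In (coord v n) lt -> exists U, List.In U l /\ U v).
    by exists l; split=> // v hv; apply: lc.
  elim: {hlt} lt => [|t lt [l [lC lc]]]; first by exists nil; split.
  have [l' [lC' lc']] := h' t.
  exists (List.app l l'); split.
    by move=> U hU; case: (List.in_app_or _ _ _ hU); [apply: lC|apply: lC'].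
  move=> v hv /= [e|hin].
    by have [U [UU Uv]] := lc' v hv (esym e); exists U; split=> //; apply: List.in_or_app; right.
  by have [U [UU Uv]] := lc v hv hin; exists U; split=> //; apply: List.in_or_app; left.
have [F hF] : exists F : nat -> dprod T -> dprod T, forall n u, bad n u ->
    agree n u (F n u) /\ bad n.+1 (F n u).
  suff /choice [F hF] : forall n, exists Fn : dprod T -> dprod T, forall u, bad n u ->
      agree n u (Fn u) /\ bad n.+1 (Fn u) by exists F.
  move=> n; suff /choice [F hF] : forall u, exists v, bad n u -> agree n u v /\ bad n.+1 v.
    by exists F.
  move=> u; have [/step [v hv]|nb] := pselect (bad n u); first by exists v.
  by exists u.
pose s := fix s n : dprod T := if n is m.+1 then F m (s m) else 0.
have bs n : bad n (s n).
  elim: n => [|n IH]; last by have [] := hF _ _ IH.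
  move=> [l [lC lc]]; apply: nfin; exists l; split=> // v _; exact: lc.
have ag n k : agree n (s n) (s (n + k)%N).
  elim: k => [|k IH]; first by rewrite addn0.
  move=> i hi; rewrite addnS /=.
  have [a _] := hF _ _ (bs (n + k)%N).
  by rewrite a ?IH //; apply: leq_trans hi (leq_addr _ _).
pose w : dprod T := fun n => coord (s n.+1) n.
have agw n : agree n (s n) w.
  by move=> i hi; rewrite /w {1}/coord -(subnKC hi) ag.
have [U [CU Uw]] := cC w I.
have /dprod_openP /(_ _ Uw) [n hn] := oC _ CU.
apply: (bs n.+1); exists (cons U nil); split=> [V [<-|[]] //|v hv].
exists U; split; first by left.
by apply: hn => i hi; rewrite hv // (agw n.+1).
Qed.

End ProductCompact.


Section SubGroup.
Variables (G : topgroup) (S : G -> Prop).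

Definition tg_subgroup : Prop :=
  [/\ S (tg_one G), forall x y, S x -> S y -> S (x ** y) & forall x, S x -> S (tg_inv x)].

Hypothesis hS : tg_subgroup.

Let sT := {x : G | S x}.

Lemma sub_tg_inj (x y : sT) : sval x = sval y -> x = y.
Proof. by case: x y => [x px] [y py] /= e; subst y; congr exist; exact: Prop_irrelevance. Qed.

Definition sub_tg_one : sT := let: And3 h _ _ := hS in exist _ _ h.
Definition sub_tg_mul (x y : sT) : sT :=
  exist _ (sval x ** sval y) (let: And3 _ h _ := hS in h _ _ (svalP x) (svalP y)).
Definition sub_tg_inv (x : sT) : sT :=
  exist _ (tg_inv (sval x)) (let: And3 _ _ h := hS in h _ (svalP x)).
Definition sub_tg_open (U : sT -> Prop) : Prop :=
  exists O, tg_open O /\ forall x, U x <-> O (sval x).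

Lemma sub_tg_oneE : sval sub_tg_one = tg_one G.
Proof. by rewrite /sub_tg_one; case: hS. Qed.

Definition sub_topgroup : topgroup.
Proof.
refine (@TopGroup sT sub_tg_mul sub_tg_one sub_tg_inv sub_tg_open _ _ _ _ _ _ _ _ _ _).
- by move=> x y z; apply: sub_tg_inj; rewrite /= tg_mulA.
- by move=> x; apply: sub_tg_inj; rewrite /= sub_tg_oneE tg_mul1x.
- by move=> x; apply: sub_tg_inj; rewrite /= sub_tg_oneE tg_mulx1.
- by move=> x; apply: sub_tg_inj; rewrite /= sub_tg_oneE tg_mulVx.
- by move=> x; apply: sub_tg_inj; rewrite /= sub_tg_oneE tg_mulxV.
- by exists (fun=> True); split=> //; exact: tg_open_full.
- move=> U V [O [oO hO]] [O' [oO' hO']]; exists (fun x => O x /\ O' x).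
  split; first exact: tg_open_inter.
  by move=> x; rewrite hO hO'.
- move=> F hF.
  exists (fun x => exists O, (tg_open O /\ exists U, F U /\ forall y, U y <-> O (sval y)) /\ O x).
  split; first by apply: tg_open_union => O [].
  move=> x; split.
    move=> [U [FU Ux]]; have [O [oO hO]] := hF _ FU.
    by exists O; split; [split=> //; exists U|apply/hO].
  by move=> [O [[_ [U [FU hU]]] Ox]]; exists U; split=> //; apply/hU.
- move=> U [O [oO hO]] x y /hO Oxy.
  have [V [W [oV [oW [Vx [Wy s]]]]]] := tg_mul_cont oO Oxy.
  exists (fun z => V (sval z)), (fun z => W (sval z)).
  split; first by exists V.
  split; first by exists W.
  by split=> //; split=> // a b Va Wb; apply/hO; apply: s.
- move=> U [O [oO hO]]; exists (fun x => O (tg_inv x)); split; first exact: tg_inv_cont.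
  by move=> x; rewrite hO.
Defined.

Lemma sub_topgroup_hausdorff : hausdorff G -> hausdorff sub_topgroup.
Proof.
move=> hG x y nxy.
have [|U [V [oU [oV [Ux [Vy UV]]]]]] := hG (sval x) (sval y).
  by move=> /sub_tg_inj.
exists (fun z => U (sval z)), (fun z => V (sval z)).
split; first by exists U.
split; first by exists V.
by split=> //; split=> // z; exact: UV.
Qed.

Lemma sub_topgroup_commutative : tg_commutative G -> tg_commutative sub_topgroup.
Proof. by move=> cG x y; apply: sub_tg_inj; exact: cG. Qed.

(** Closed in compact: lift the cover to open sets of [G], add the complement of [S], extract a
    finite cover of [K], and discard the complement. *)
Lemma sub_topgroup_compact K : compact K -> (forall x, S x -> K x) ->
  tg_open (fun x => ~ S x) -> compact (fun _ : sub_topgroup => True).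
Proof.
move=> cK SK oS C oC cC.
pose lift (O : G -> Prop) := tg_open O /\
  exists U : sT -> Prop, C U /\ forall y, U y <-> O (sval y).
have [||l [lC lc]] := cK (fun O => O = (fun x => ~ S x) \/ lift O).
- by move=> O [->|[]].
- move=> x Kx; have [Sx|nSx] := pselect (S x); last first.
    by exists (fun x => ~ S x); split=> //; left.
  have [U [CU Ux]] := cC (exist _ x Sx) I; have [O [oO hO]] := oC _ CU.
  exists O; split; first by right; split=> //; exists U.
  by apply/(hO (exist _ x Sx)).
have {}lc x : S x -> exists O, List.In O l /\ O x by move=> /SK /lc.
suff [l' [lC' lc']] : exists l' : list (sT -> Prop), (forall U, List.In U l' -> C U) /\
    forall O x, List.In O l -> O (sval x) -> exists U, List.In U l' /\ U x.
  exists l'; split=> // x _; have [O [Ol Ox]] := lc _ (svalP x).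
  exact: lc' Ol Ox.
elim: l lC {lc} => [|O l IH] lC; first by exists nil; split=> // ? ? [].
have [|l' [lC' lc']] := IH; first by move=> U hU; apply: lC; right.
case: (lC O (or_introl erefl)) => [e|[oO [U [CU hU]]]].
  exists l'; split=> // O' x [<-|]; last exact: lc'.
  by rewrite e => /(_ (svalP x)).
exists (cons U l'); split=> [V [<-|/lC']|O' x [<-|hO'] Ox] //.
  by exists U; split; [left|apply/hU].
by have [V [Vl Vx]] := lc' _ _ hO' Ox; exists V; split=> //; right.
Qed.

End SubGroup.

(** The closure of the subgroup generated by [x]; quotients of natural powers replace integer
    powers. *)
Definition cyclic_closure (G : topgroup) (x y : G) : Prop :=
  forall U, tg_open U -> U y -> exists m n, U (tg_pow x m ** tg_inv (tg_pow x n)).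

Section Monothetic.
Variables (G : topgroup) (cG : tg_commutative G) (x : G).

Lemma cyclic_closure_open : tg_open (fun y => ~ cyclic_closure x y).
Proof.
apply: tg_open_local => y; rewrite /cyclic_closure => /existsNP [U /not_implyP [oU]].
move=> /not_implyP [Uy nU]; exists U; split=> //; split=> // z Uz /(_ U oU Uz).
exact: nU.
Qed.

Lemma cyclic_closure_id : cyclic_closure x x.
Proof. by move=> U _ Ux; exists 1%N, 0%N; rewrite /= tg_inv1 !tg_mulx1. Qed.

Lemma cyclic_closure_subgroup : tg_subgroup (cyclic_closure x).
Proof.
split.
- by move=> U _ U1; exists 0%N, 0%N; rewrite /= tg_inv1 tg_mulx1.
- move=> y z hy hz U oU Uyz.
  have [V [W [oV [oW [Vy [Wz s]]]]]] := tg_mul_cont oU Uyz.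
  have [m [n Vmn]] := hy _ oV Vy; have [m' [n' Wmn]] := hz _ oW Wz.
  exists (m + m')%N, (n + n')%N.
  have := s _ _ Vmn Wmn; congr U.
  rewrite !tg_powD tg_invM (cG (tg_inv (tg_pow x n'))) !tg_mulA; congr (_ ** _).
  by rewrite -!tg_mulA; congr (_ ** _); exact: cG.
- move=> y hy U oU Uy.
  have [m [n Umn]] := hy _ (tg_inv_cont oU) Uy.
  by exists n, m; move: Umn; rewrite tg_invM tg_invK.
Qed.

Definition monothetic : topgroup := sub_topgroup cyclic_closure_subgroup.

Definition monothetic_gen : monothetic := exist _ x cyclic_closure_id.

End Monothetic.

(** * Extension of homomorphisms *)

Lemma pairMz (M D : zmodType) (u : M) (v : D) (k : int) :
  (u, v) *~ k = (u *~ k, v *~ k).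
Proof.
have pairMn n : (u, v) *+ n = (u *+ n, v *+ n).
  by elim: n => [|n IH]; rewrite ?mulr0n // !mulrS IH.
by case: k => n; rewrite ?NegzE ?mulrNz -?pmulrn pairMn.
Qed.

Section HomExtension.
Variables M D : zmodType.

(** A homomorphism on an unnamed subgroup of [M], encoded by its graph: a subgroup of the product
    that is single-valued at 0. Unions of chains are then plain set unions. *)
Definition partial_hom (g : set (M * D)) : Prop :=
  [/\ g (0, 0), (forall p q, g p -> g q -> g (p - q)) & forall d, g (0, d) -> d = 0].

Lemma partial_homMz g p (k : int) : partial_hom g -> g p -> g (p *~ k).
Proof.
case=> g0 gB _ gp.
have gN q : g q -> g (- q) by rewrite -sub0r; apply: gB.
have gn n : g (p *+ n).
  elim: n => [|n IH]; first by rewrite mulr0n.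
  by rewrite mulrSr -[p in _ + p]opprK; apply: gB => //; apply: gN.
by case: k => n; [exact: gn|rewrite NegzE mulrNz; apply/gN/gn].
Qed.

Lemma partial_hom_uniq g x d d' : partial_hom g -> g (x, d) -> g (x, d') -> d = d'.
Proof.
case=> _ gB g1 h h'; apply/eqP; rewrite -subr_eq0; apply/eqP/g1.
by have := gB _ _ h h'; rewrite /= -[(x, d) - _]/(x - x, d - d') subrr.
Qed.

(** Zorn's lemma on graphs. The first hypothesis is the one-step extension: [y] is a value at [x]
    compatible with every multiple of [x] already in the domain. *)
Lemma hom_extension (g0 : set (M * D)) :
  (forall g, partial_hom g -> forall x : M, exists y : D,
     forall (k : int) d, g (x *~ k, d) -> d = y *~ k) ->
  partial_hom g0 ->
  exists phi : M -> D, (forall a b, phi (a + b) = phi a + phi b) /\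
    (forall x d, g0 (x, d) -> phi x = d).
Proof.
move=> ext h0.
(* Building [g0] into the predicate handles the empty chain and makes the maximal graph extend
   [g0]. *)
pose P (A : set (M * D)) := partial_hom (fun p => A p \/ g0 p).
have [|A [PA maxA]] := @Zorn_bigcup _ P.
  move=> F FP tF; have [h00 h0B h01] := h0.
  split; first by right.
    move=> p q [[X FX Xp]|hp] [[Y FY Yq]|hq].
    - have [XY|YX] := tF _ _ FX FY.
        have [_ gB _] := FP _ FY.
        by case: (gB p q (or_introl (XY _ Xp)) (or_introl Yq)) => [h|h]; [left; exists Y|right].
      have [_ gB _] := FP _ FX.
      by case: (gB p q (or_introl Xp) (or_introl (YX _ Yq))) => [h|h]; [left; exists X|right].
    - have [_ gB _] := FP _ FX.
      by case: (gB p q (or_introl Xp) (or_intror hq)) => [h|h]; [left; exists X|right].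
    - have [_ gB _] := FP _ FY.
      by case: (gB p q (or_intror hp) (or_introl Yq)) => [h|h]; [left; exists Y|right].
    - by right; apply: h0B.
  move=> d [[X FX Xd]|]; last exact: h01.
  by have [_ _ ] := FP _ FX; apply; left.
pose g : set (M * D) := fun p => A p \/ g0 p.
have tot x : exists d, g (x, d).
  apply: contrapT => nx.
  have [y hy] := ext _ PA x.
  pose B : set (M * D) := fun p => exists q (k : int), g q /\ p = q + (x, y) *~ k.
  have AB p : g p -> B p by move=> gp; exists p, 0; rewrite mulr0z addr0.
  have [g_0 gB g1] := PA.
  apply: (maxA B).
    split; first by move=> p Ap; apply: AB; left.
    move=> BA; apply: nx; exists y; left; apply: BA; exists 0, 1.
    by rewrite mulr1z add0r.
  have -> : P B = partial_hom B.
    by congr partial_hom; apply: funextP => p; split=> [[//|h]|]; [apply: AB; right|left].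
  split; first exact: AB.
    move=> p q [p' [k [gp ->]]] [q' [l [gq ->]]].
    exists (p' - q'), (k - l); split; first exact: gB.
    by rewrite mulrzBr opprD addrACA.
  move=> d [[u v] [k [guv]]] e.
  have [e1 e2] : 0 = u + x *~ k /\ d = v + y *~ k.
    by rewrite pairMz in e; case: e.
  have eu : u = x *~ (- k) by rewrite mulrNz; apply/eqP; rewrite -addr_eq0 -e1.
  have := hy (- k) v; rewrite -eu => /(_ guv) ev.
  by rewrite e2 ev mulrNz addNr.
have /choice [phi hphi] := tot.
exists phi; split=> [a b|x d gxd]; last first.
  by apply: (partial_hom_uniq PA) (hphi x) _; right.
have [_ gB _] := PA.
apply: (partial_hom_uniq PA) (hphi _) _.
have h0b : g (- b, - phi b).
  by have := gB _ _ (let: And3 h _ _ := PA in h) (hphi b);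
    rewrite -[(0, 0) - _]/(0 - b, 0 - phi b) !sub0r.
by have := gB _ _ (hphi a) h0b; rewrite -[(a, _) - _]/(a - - b, phi a - - phi b) !opprK.
Qed.

End HomExtension.

Section SumFunctional.
Variables (K H : zmodType) (th : K -> H).
Hypothesis thD : forall a b, th (a + b) = th a + th b.
Hypothesis ext : forall g : set (dprod (fun=> K) * H), partial_hom g ->
  forall x, exists y, forall (k : int) d, g (x *~ k, d) -> d = y *~ k.

Let P := dprod (fun=> K).

(* A homomorphism extending the sum of coordinates on finitely supported sequences. *)
Lemma sum_functional : exists phi : P -> H, (forall a b, phi (a + b) = phi a + phi b) /\
  forall n (t : K), phi (fun i => if i == n then t else 0) = th t.
Proof.
have th0 : th 0 = 0 by apply: (addrI (th 0)); rewrite -thD !addr0.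
have thB a b : th (a - b) = th a - th b.
  by apply: (addIr (th b)); rewrite -thD !subrK.
pose g0 : set (P * H) := fun p => exists N, (forall n, (N <= n)%N -> coord p.1 n = 0) /\
  p.2 = \sum_(0 <= n < N) th (coord p.1 n).
have sumE (u : P) N N' : (N <= N')%N -> (forall n, (N <= n)%N -> coord u n = 0) ->
    \sum_(0 <= n < N') th (coord u n) = \sum_(0 <= n < N) th (coord u n).
  move=> le hu; rewrite (big_cat_nat (leq0n N) le) /= [X in _ + X]big1_seq ?addr0 //.
  by move=> i /=; rewrite mem_index_iota => /andP [hi _]; rewrite hu ?th0.
have [|phi [phiD phi0]] := @hom_extension P H g0 ext.
  split; first by exists 0%N; rewrite big_nil.
    move=> [u d] [v d'] [N [hu /= ->]] [N' [hv /= ->]].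
    rewrite -(sumE u _ _ (leq_maxl N N') hu) -(sumE v _ _ (leq_maxr N N') hv).
    rewrite -[(u, _) - _]/(u - v, _ - _).
    exists (maxn N N'); split=> [n|]; rewrite [_.1]/= ?[_.2]/=.
      by rewrite geq_max => /andP [h h']; rewrite coordB hu // hv // subrr.
    rewrite -sumrB.
    by apply: eq_bigr => i _; rewrite -thB coordB.
  move=> d [N [_ /= ->]]; apply: big1 => i _; exact: th0.
exists phi; split=> // n t; apply: phi0; exists n.+1; split=> /= [m hm|].
  by rewrite /coord; case: eqP hm => // ->; rewrite ltnn.
rewrite big_nat_recr //= /coord eqxx big1_seq ?add0r // => i /=.
rewrite mem_index_iota => /andP [_ hi].
by case: eqP hi => [->|]; rewrite ?ltnn.
Qed.

(** Sequences with the single entry [t] at place [n] tend to 0 as [n] grows, while the functional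
    keeps the value [th t] on them. *)
Lemma sum_functional_not_open : (exists t, th t <> 0) ->
  exists phi : dprod_topgroup (fun=> K) -> H, ghom phi /\
    ~ tg_open (fun u : dprod_topgroup (fun=> K) => phi u = 0).
Proof.
move=> [t ht]; have [phi [phiD phie]] := sum_functional.
exists phi; split=> // /dprod_open0 h.
have [|n hn] := h; first by apply: (addrI (phi 0)); rewrite -phiD !addr0.
apply: ht; rewrite -(phie n.+1); apply: hn => i hi; rewrite /coord.
by case: eqP hi => // ->; rewrite ltnn.
Qed.

End SumFunctional.

(** Linear algebra over the field with [p] elements: by Bezout, a multiple of [x] by an integer
    prime to [p] in the domain puts [x] itself there. Otherwise only zero multiples of [x] occur,
    and the value 0 is free to choose. *)
Lemma ext_prime_exponent (M H : zmodType) p : prime p -> (forall x : M, x *+ p = 0) ->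
  forall g : set (M * H), partial_hom g ->
  forall x, exists y, forall (k : int) d, g (x *~ k, d) -> d = y *~ k.
Proof.
move=> pp hp g hg x.
have [[y gy]|nx] := pselect (exists y, g (x, y)).
  exists y => k d gd; apply: (partial_hom_uniq hg) gd _.
  by have := partial_homMz k hg gy; rewrite pairMz.
exists 0 => k d gd; rewrite mul0rz.
have [dv|ndv] := boolP (p %| k)%Z.
  move/dvdzP: dv gd => [q ->]; rewrite mulrC mulrzA -pmulrn hp mul0rz.
  by have [_ _] := hg; apply.
exfalso; apply: nx.
have cop : coprimez k p by rewrite coprimez_sym coprimezE absz_nat prime_coprime.
have [[u v] /= uv] := coprimezP _ _ cop.
exists (d *~ u); have := partial_homMz u hg gd; rewrite pairMz; congr (g (_, _)).
have -> : x *~ k *~ u = x *~ (u * k + v * p).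
  by rewrite mulrzDr -[v * p](mulrC (p : int)) (mulrzA x p) -pmulrn hp mul0rz addr0 mulrC mulrzA.
by rewrite uv mulr1z.
Qed.

(** One nonzero multiple of [x] in the domain dictates the value by division, and the other
    multiples agree because [rat] is torsion-free. *)
Lemma ext_rat (M : zmodType) : forall g : set (M * rat), partial_hom g ->
  forall x, exists y, forall (k : int) d, g (x *~ k, d) -> d = y *~ k.
Proof.
move=> g hg x.
have [[l [e [l0 ge]]]|nx] := pselect (exists (l : int) e, l != 0 /\ g (x *~ l, e)).
  exists (e / l%:~R) => k d gd.
  have := partial_homMz l hg gd; rewrite pairMz -mulrzA => h1.
  have := partial_homMz k hg ge; rewrite pairMz -mulrzA [l * k]mulrC => h2.
  have e1 : d *~ l = e *~ k := partial_hom_uniq hg h1 h2.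
  move: e1; rewrite -(mulrzr d) -(mulrzr e) -(mulrzr (_ / _)) => e1.
  have l0' : l%:~R != 0 :> rat by rewrite intr_eq0.
  by apply: (mulIf l0'); rewrite e1 mulrAC divfK.
exists 0 => k d gd; rewrite mul0rz; have [k0|k0] := eqVneq k 0.
  by move: gd; rewrite k0 mulr0z; have [_ _] := hg; apply.
by exfalso; apply: nx; exists k, d.
Qed.

(** * Consequences of slenderness *)

Lemma In_mem (T : eqType) (s : seq T) t : t \in s -> List.In t s.
Proof.
elim: s => //= a s IH; rewrite inE => /orP [/eqP ->|/IH h]; by [left|right].
Qed.

Lemma prime_torsion (H : zmodType) : ~ torsion_free H ->
  exists p (x : H), [/\ prime p, x <> 0 & x *+ p = 0].
Proof.
move=> /existsNP [x /existsNP [n /not_implyP [n1 /not_implyP [xn x0]]]].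
elim/ltn_ind: n x n1 xn x0 => n IH x n1 xn x0.
have [e|n2] := eqVneq n 1%N; first by move: xn; rewrite e mulr1n.
have n_gt1 : (1 < n)%N by rewrite ltn_neqAle eq_sym n2.
have [xp|xp] := pselect (x *+ pdiv n = 0).
  by exists (pdiv n), x; split=> //; exact: pdiv_prime.
have pg1 := prime_gt1 (pdiv_prime n_gt1).
apply: (IH (n %/ pdiv n)%N _ (x *+ pdiv n)) => //.
- exact: ltn_Pdiv.
- by rewrite divn_gt0 ?pdiv_gt0 // dvdn_leq // pdiv_dvd.
- by rewrite -mulrnA mulnC divnK // pdiv_dvd.
Qed.

Lemma ordS_exponent q (t : 'I_q.+1) : t *+ q.+1 = 0.
Proof. by rewrite Zp_mulrn; apply: val_inj; rewrite /= modnMl. Qed.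

Lemma prime_torsion_functional (H : zmodType) q (x : H) :
  prime q.+1 -> x <> 0 -> x *+ q.+1 = 0 ->
  exists phi : dprod_topgroup (fun=> 'I_q.+1) -> H, ghom phi /\
    ~ tg_open (fun u : dprod_topgroup (fun=> 'I_q.+1) => phi u = 0).
Proof.
move=> pq x0 xq.
have xmod n : x *+ (n %% q.+1) = x *+ n.
  by rewrite {2}(divn_eq n q.+1) mulrnDr mulnC mulrnA xq mul0rn add0r.
apply: (@sum_functional_not_open 'I_q.+1 H (fun t => x *+ t)).
- by move=> a b; rewrite /= xmod mulrnDr.
- apply: (ext_prime_exponent pq) => u; apply: coord_inj => n.
  by rewrite coordMn ordS_exponent.
- by exists (inord 1); rewrite inordK ?mulr1n //; exact: prime_gt1.
Qed.

Lemma cm_slender_torsion_free H : cm_slender H -> torsion_free H.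
Proof.
move=> sl; apply: contrapT => /prime_torsion [[|q] [x [] //]] pq x0 xq.
have [phi [hphi no]] := prime_torsion_functional pq x0 xq; apply: no.
exact: sl (dprod_completely_metrizable _) _ hphi.
Qed.

Lemma compact_locally_compact (G : topgroup) :
  compact (fun _ : G => True) -> locally_compact G.
Proof.
by move=> cG x; exists (fun=> True), (fun=> True); split=> //; exact: tg_open_full.
Qed.

Lemma lcH_slender_torsion_free H : lcH_slender H -> torsion_free H.
Proof.
move=> sl; apply: contrapT => /prime_torsion [[|q] [x [] //]] pq x0 xq.
have [phi [hphi no]] := prime_torsion_functional pq x0 xq; apply: no.
apply: sl hphi; last exact/hausdorff_metrizable/dprod_completely_metrizable.
apply/compact_locally_compact/dprod_compact => n.
by exists (enum 'I_q.+1) => t; apply: In_mem; rewrite mem_enum.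
Qed.

Lemma cm_slender_reduced H : cm_slender H -> reduced H.
Proof.
move=> sl [j [jD jI]].
have j0 : j 0 = 0 by apply: (addrI (j 0)); rewrite -jD !addr0.
have [|phi [hphi no]] := @sum_functional_not_open rat rat id (fun _ _ => erefl) (@ext_rat _).
  by exists 1; apply/eqP; exact: oner_neq0.
apply: no.
have := sl _ (dprod_completely_metrizable _) (fun u => j (phi u)).
have -> : (fun u : dprod_topgroup (fun=> rat) => phi u = 0) = (fun u => j (phi u) = 0).
  by apply: funextP => u; split=> [->|] //; rewrite -{1}j0 => /jI.
by apply=> u v; rewrite hphi jD.
Qed.

Lemma cm_slender_no_polish H : cm_slender H -> no_nondiscrete_polish_subgroup H.
Proof.
move=> sl [K [f [[cK _] [nd [hf fI]]]]]; apply: nd => U.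
have oker := sl _ cK _ hf.
apply: tg_open_local => x Ux; exists (fun y => f (tg_inv x ** y) = 0); split.
  exact: (tg_continuous_mul (tg_continuous_cst _) (@tg_continuous_id K) oker).
rewrite tg_mulVx ghom1 //; split=> // y.
rewrite -(ghom1 hf) => /fI e.
by rewrite -(tg_mul1x y) -(tg_mulxV x) -tg_mulA e tg_mulx1.
Qed.

(** The fibres of [f] are cosets of an open subgroup, so finitely many cover [C]; by pigeonhole two
    distinct powers of [c] share a fibre. *)
Lemma compact_open_ker_torsion (C : topgroup) (H : zmodType) (f : C -> H) c :
  compact (fun _ : C => True) -> ghom f -> tg_open (fun x => f x = 0) ->
  exists2 n, (0 < n)%N & f c *+ n = 0.
Proof.
move=> cC hf oker.
have [||l [lU lc]] := cC (fun U => exists h, U = (fun x => f x = h)).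
- move=> U [h ->]; apply: tg_open_local => x fx.
  exists (fun y => f (tg_inv x ** y) = 0); split.
    exact: (tg_continuous_mul (tg_continuous_cst _) (@tg_continuous_id C) oker).
  rewrite tg_mulVx ghom1 //; split=> // y.
  by rewrite hf (ghomV hf) => /eqP; rewrite addrC subr_eq0 => /eqP ->.
- by move=> x _; exists (fun y => f y = f x); split=> //; exists (f x).
have idx n : exists k : 'I_(size l), exists h,
    nth (fun=> True) l k = (fun x => f x = h) /\ f (tg_pow c n) = h.
  have [U [Ul Ux]] := lc (tg_pow c n) I.
  have [h eU] := lU _ Ul.
  have [k [kl ek]] : exists k, (k < size l)%N /\ nth (fun=> True) l k = U.
    elim: l Ul {lU lc} => //= V l IH [->|/IH [k [kl ek]]]; first by exists 0%N.
    by exists k.+1.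
  exists (Ordinal kl), h; split; first by rewrite /= ek.
  by rewrite eU in Ux.
have /choice [k hk] := idx.
have ninj : ~ injective (fun n : 'I_(size l).+1 => k n).
  by move=> /leq_card; rewrite !card_ord ltnn.
move: ninj => /existsNP [m /existsNP [n /not_implyP [emn nmn]]].
have eqf : f c *+ m = f c *+ n.
  have [h [e1 e2]] := hk m; have [h' [e1' e2']] := hk n.
  rewrite emn e1' in e1; rewrite -!(ghomX hf) e2.
  have := congr1 (fun U => U (tg_pow c n)) e1 => /= E.
  by rewrite E in e2'; rewrite e2'.
have [lt|lt|e] := ltngtP m n; last by case: nmn; apply: val_inj.
- exists (n - m)%N; first by rewrite subn_gt0.
  by rewrite mulrnBr ?eqf ?subrr // ltnW.
- exists (m - n)%N; first by rewrite subn_gt0.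
  by rewrite mulrnBr ?eqf ?subrr // ltnW.
Qed.

(** The composite of the retraction, the surjection and the embedding maps a compact group to [H];
    slenderness makes its values torsion, and [H] is torsion-free. *)
Lemma lcH_slender_cotorsion_free H : lcH_slender H -> cotorsion_free H.
Proof.
move=> sl B j jD jI [A [f [[C [i [r [_ [cC [hC [iD [hr ri]]]]]]]] [fD fS]]]] b.
have tf := lcH_slender_torsion_free sl.
have [a fa] := fS b.
pose F x := j (f (r x)).
have hF : ghom F by move=> x y; rewrite /F hr fD jD.
have oF := sl _ (compact_locally_compact cC) hC _ hF.
have [n n0 Fn] := compact_open_ker_torsion (i a) cC hF oF.
have : F (i a) = 0 by exact: tf n0 Fn.
have j0 : j 0 = 0 by apply: (addrI (j 0)); rewrite -jD !addr0.
by rewrite /F ri fa -{1}j0 => /jI.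
Qed.

(** * Nested roots in completely metrizable groups *)

Definition zadic_separated (H : zmodType) : Prop :=
  forall x : H, (forall n, exists g, x = g *+ n`!) -> x = 0.

Lemma torsion_freeMz (H : zmodType) (x : H) (k : int) :
  torsion_free H -> k != 0 -> x *~ k = 0 -> x = 0.
Proof.
move=> tf; case: k => n; first by case: n => // n _; apply: tf.
by rewrite NegzE mulrNz => _ /eqP; rewrite oppr_eq0 => /eqP; apply: tf.
Qed.

(* In a torsion-free group a nonzero element divisible by every n! spans a copy of rat. *)
Lemma zadic_separated_of_reduced H : torsion_free H -> reduced H -> zadic_separated H.
Proof.
move=> tf red x hx; apply: contrapT => x0; apply: red.
have tfz (y : H) (k : int) : k != 0 -> y *~ k = 0 -> y = 0 by apply: torsion_freeMz.
have /choice [phi hphi] : forall q : rat, exists y : H, y *~ denq q = x *~ numq q.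
  move=> q; have := denq_gt0 q; case: (denq q) => [[|m]|] // _.
  have [g ->] := hx m.+1.
  (* The denominator is [m + 1] and [x] is [(m + 1)!] times [g], so [m!] times [g] is [x] divided by
     the denominator. *)
  exists (g *+ m`! *~ numq q).
  by rewrite mulrzAC -pmulrn -mulrnA mulnC factS.
(* Torsion-freeness makes the defining relation hold for unreduced fractions too, so sums can be
   compared over a common denominator. *)
have key q (d n : int) : q * d%:~R = n%:~R -> phi q *~ d = x *~ n.
  move=> e; apply/eqP; rewrite -subr_eq0; apply/eqP.
  apply: (tfz _ (denq q)); first exact: denq_neq0.
  rewrite mulrzBl mulrzAC hphi -!mulrzA.
  suff -> : numq q * d = n * denq q by rewrite subrr.
  by apply: (@intr_inj rat); rewrite !rmorphM /= -e numqE mulrAC.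
exists phi; split=> a b.
  apply/eqP; rewrite -subr_eq0; apply/eqP.
  apply: (tfz _ (denq a * denq b)); first by rewrite mulf_neq0 ?denq_neq0.
  rewrite mulrzBl mulrzDl (key _ _ (numq a * denq b + numq b * denq a)).
    rewrite (key a _ (numq a * denq b)) ?(key b _ (numq b * denq a)) ?mulrzDr ?subrr //.
      by rewrite !rmorphM /= numqE mulrCA mulrC -!mulrA.
    by rewrite !rmorphM /= numqE -!mulrA.
  by rewrite rmorphD !rmorphM /= !numqE mulrDl; congr (_ + _); rewrite -!mulrA // [X in b * X]mulrC.
move=> e.
have ab : numq a * denq b = numq b * denq a.
  apply/eqP; rewrite -subr_eq0; apply: contrapT => /negP n0; apply: x0.
  apply: (tfz _ _ n0).
  rewrite mulrzBr -(key a (denq a * denq b)) -?(key b (denq a * denq b)) ?e ?subrr //.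
    by rewrite !rmorphM /= numqE -!mulrA [X in b * X]mulrC.
  by rewrite !rmorphM /= numqE -!mulrA.
have := congr1 (fun k : int => k%:~R : rat) ab; rewrite /= !rmorphM /= !numqE.
have d0 c : (denq c)%:~R != 0 :> rat by rewrite intr_eq0 denq_neq0.
by rewrite mulrAC => /(mulIf (d0 a)) /(mulIf (d0 b)).
Qed.

Section NestedLimits.
Variables (G : topgroup) (d : G -> G -> R).
Hypotheses (dm : is_metric d) (di : metric_induces d) (dc : metric_complete d).

Let d0 x : d x x = 0%Re. Proof. by have [_ [ds _]] := dm; apply/ds. Qed.
Let dC x y : d x y = d y x. Proof. by have [_ [_ [h _]]] := dm. Qed.
Let dT x y z : (d x z <= d x y + d y z)%Re. Proof. by have [_ [_ [_ h]]] := dm. Qed.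

Lemma metric_open_ball x e : tg_open (fun w => d x w < e)%Re.
Proof.
apply/di => w hw; exists (e - d x w)%Re; split; first lra.
by move=> v hv; have := dT x w v; lra.
Qed.

(** Stands in for the finiteness of the family of words built so far: this is the one consequence of
    finiteness that the construction uses. *)
Definition equicontinuous (P : (G -> G) -> Prop) : Prop :=
  forall y e, (0 < e)%Re -> exists W, [/\ tg_open W, W y &
    forall w g, W w -> P g -> (d (g y) (g w) < e)%Re].

(* The partial compositions of the maps w |-> x m ^ a * w ^ m.+1 that are available
   after one more generator x has been chosen. *)
Definition extend_words m (x : G) (P : (G -> G) -> Prop) (g' : G -> G) : Prop :=
  g' = id \/ exists g a, [/\ P g, (a <= m.+1)%N &
    g' = (fun w => g (tg_pow x a ** tg_pow w m.+1))].

Lemma equicontinuous_extend m x P : equicontinuous P -> equicontinuous (extend_words m x P).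
Proof.
move=> eP y e e0.
have /choice [V hV] : forall a, exists V, [/\ tg_open V, V y &
    forall w g, V w -> P g -> (d (g (tg_pow x a ** tg_pow y m.+1))
       (g (tg_pow x a ** tg_pow w m.+1)) < e)%Re].
  move=> a; have [W [oW Wy hW]] := eP (tg_pow x a ** tg_pow y m.+1) _ e0.
  exists (fun w => W (tg_pow x a ** tg_pow w m.+1)); split=> //; last by move=> w g; apply: hW.
  exact: (tg_continuous_mul (tg_continuous_cst _) (@tg_continuous_pow G m.+1)).
exists (fun w => d y w < e /\ forall a, (a <= m.+1)%N -> V a w)%Re; split.
- apply: tg_open_inter; first exact: metric_open_ball.
  by apply: tg_open_bigcap => a _; have [] := hV a.
- by split=> [|a _]; [rewrite d0|have [] := hV a].
- move=> w g' [dw Vw] [->|[g [a [Pg am ->]]]] //.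
  by have [_ _] := hV a; apply=> //; apply: Vw.
Qed.

Variables (H : zmodType) (f : G -> H).
Hypotheses (hf : ghom f) (nk : ~ tg_open (fun x => f x = 0)).

(** Shrink the neighbourhood of 1 until the powers of [x] with admissible digits all stay in the set
    given by equicontinuity; the non-open kernel still meets it outside the zeros of [f]. *)
Lemma small_generator m P : equicontinuous P -> exists x, f x <> 0 /\
  forall g a, P g -> (a <= m.+1)%N -> (d (g (tg_one G)) (g (tg_pow x a)) < (/ 2) ^ m)%Re.
Proof.
move=> eP; have [|W [oW W1 hW]] := eP (tg_one G) ((/ 2) ^ m)%Re.
  by apply: pow_lt; lra.
pose V x := forall a, (a <= m.+1)%N -> W (tg_pow x a).
have oV : tg_open V.
  by apply: (tg_open_bigcap (P := fun a x => W (tg_pow x a))) => a _; exact: tg_continuous_pow.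
have V1 : V (tg_one G) by move=> a _; rewrite tg_pow1.
have [x [Vx fx]] := ghom_ker_not_open hf nk oV V1.
by exists x; split=> // g a Pg am; apply: hW => //; apply: Vx.
Qed.

Lemma exists_generators : exists x : nat -> G, (forall n, f (x n) <> 0) /\
  forall a : nat -> nat, (forall n, (a n <= n.+1)%N) ->
  forall n j, (d (nested_word x a n j (tg_one G)) (nested_word x a n j.+1 (tg_one G))
    < (/ 2) ^ (n + j))%Re.
Proof.
have [X hX] : exists X : nat -> ((G -> G) -> Prop) -> G, forall m P, equicontinuous P ->
    f (X m P) <> 0 /\ forall g a, P g -> (a <= m.+1)%N ->
      (d (g (tg_one G)) (g (tg_pow (X m P) a)) < (/ 2) ^ m)%Re.
  suff /choice [X hX] : forall m, exists Xm : ((G -> G) -> Prop) -> G, forall P,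
      equicontinuous P -> f (Xm P) <> 0 /\ forall g a, P g -> (a <= m.+1)%N ->
      (d (g (tg_one G)) (g (tg_pow (Xm P) a)) < (/ 2) ^ m)%Re by exists X.
  move=> m; suff /choice [X hX] : forall P, exists x, equicontinuous P ->
      f x <> 0 /\ forall g a, P g -> (a <= m.+1)%N ->
      (d (g (tg_one G)) (g (tg_pow x a)) < (/ 2) ^ m)%Re by exists X.
  move=> P; have [/(small_generator m) [x hx]|n] := pselect (equicontinuous P); first by exists x.
  by exists (tg_one G).
pose P := fix P m : (G -> G) -> Prop :=
  if m is k.+1 then extend_words k (X k (P k)) (P k) else (fun g => g = id).
have eP m : equicontinuous (P m).
  elim: m => [|m IH]; last exact: equicontinuous_extend.
  move=> y e e0; exists (fun w => d y w < e)%Re; split; first exact: metric_open_ball.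
    by rewrite d0.
  by move=> w g dw ->.
pose x m := X m (P m).
exists x; split=> [n|a ha n j]; first by have [] := hX n _ (eP n).
(* The identity is put back into the family at every stage, so words starting at any [n] belong to
   it. *)
have Pword i : P (n + i)%N (nested_word x a n i).
  elim: i => [|i IH].
    rewrite addn0; case: n => [|n] //=; by left.
  rewrite addnS /=; right; exists (nested_word x a n i), (a (n + i)%N); split=> //.
  by apply: funext => w; rewrite -nested_word_last.
(* Adding a letter replaces the innermost argument 1 by a power of the new generator. *)
rewrite nested_word_last tg_pow1 tg_mulx1.
by have [_] := hX (n + j)%N _ (eP (n + j)%N); apply=> //; exact: Pword.
Qed.

Lemma fast_cauchy (s : nat -> G) n :
  (forall j, d (s j) (s j.+1) < (/ 2) ^ (n + j))%Re ->
  exists l, forall e, (0 < e)%Re -> exists N : nat, forall n : nat, (N <= n)%N ->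
        (d (s n) l < e)%Re.
Proof.
move=> hs.
have bnd i k : (d (s i) (s (i + k)%N) <= 2 * (/ 2) ^ (n + i))%Re.
  (* The exact geometric sum, in place of its bound, lets the induction on [k] close. *)
  suff h : (d (s i) (s (i + k)%N) <= 2 * (/ 2) ^ (n + i) - 2 * (/ 2) ^ (n + i + k))%Re.
    by have := pow_lt (/ 2) (n + i + k) (ltac:(lra)); lra.
  elim: k => [|k IH]; first by rewrite !addn0 d0; lra.
  rewrite !addnS /=; have := hs (i + k)%N; have := dT (s i) (s (i + k)%N) (s (i + k).+1).
  by rewrite addnA; lra.
apply: dc => e e0.
have [N hN] := pow_lt_1_zero (/ 2) (ltac:(rewrite Rabs_pos_eq; lra)) (e / 4) (ltac:(lra)).
exists N => m k hm hk.
have small : ((/ 2) ^ (n + N) < e / 4)%Re.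
  have := hN (n + N)%N; rewrite Rabs_pos_eq; last by apply: pow_le; lra.
  by apply; apply/leP/leq_addl.
have := bnd N (m - N)%N; have := bnd N (k - N)%N; rewrite !subnKC //.
by have := dT (s m) (s N) (s k); rewrite (dC (s m) (s N)); lra.
Qed.

(** Take [z n] to be the limit of the words starting at [n]; the recursion holds for finite words
    and passes to the limit by continuity. *)
Lemma exists_nested_roots : exists x : nat -> G, (forall n, f (x n) <> 0) /\
  forall a : nat -> nat, (forall n, (a n <= n.+1)%N) ->
  exists z : nat -> G, forall n, z n = tg_pow (x n) (a n) ** tg_pow (z n.+1) n.+1.
Proof.
have [x [fx hx]] := exists_generators.
exists x; split=> // a ha.
have /choice [z hz] n := fast_cauchy (hx a ha n).
exists z => n.
pose F w := tg_pow (x n) (a n) ** tg_pow w n.+1.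
have cF : tg_continuous F.
  exact: (tg_continuous_mul (tg_continuous_cst _) (@tg_continuous_pow G n.+1)).
have [d_ge0 [ds _]] := dm.
apply/ds; apply: Rle_antisym; last exact: d_ge0.
apply: le_epsilon => e e0; rewrite Rplus_0_l.
have e2 : (0 < e / 2)%Re by lra.
have /di /(_ (z n.+1)) [|e' [e'0 he']] := cF _ (metric_open_ball (F (z n.+1)) (e / 2)).
  by rewrite d0.
have [N hN] := hz n _ e2; have [N' hN'] := hz n.+1 _ e'0.
(* One letter more than in the word from [n.+1], so that both words end at the same place. *)
have h1 := hN (maxn N N').+1 (leqW (leq_maxl _ _)).
have h2 := he' (nested_word x a n.+1 (maxn N N') (tg_one G)).
have {}h2 := h2 (ltac:(rewrite dC; exact: hN' (leq_maxr _ _))).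
pose w := F (nested_word x a n.+1 (maxn N N') (tg_one G)).
rewrite -/w in h2; rewrite -[nested_word x a n _.+1 _]/w in h1; rewrite -/(F (z n.+1)).
by have := dT (z n) w (F (z n.+1)); rewrite (dC (z n) w) (dC w (F _)); lra.
Qed.

End NestedLimits.

(** * The Polish group of series values *)

Lemma real_inf (E : R -> Prop) : (exists r, E r) -> (forall r, E r -> (0 <= r)%Re) ->
  exists m, (forall r, E r -> (m <= r)%Re) /\
    (forall r, (m < r)%Re -> exists r', E r' /\ (r' < r)%Re).
Proof.
move=> [r0 Er0] pos.
have [||m [ub lub]] := completeness (fun x => E (- x)%Re).
- by exists 0%Re => x /pos; lra.
- by exists (- r0)%Re; rewrite Ropp_involutive.
exists (- m)%Re; split=> [r Er|r hr].
  have /ub : E (- - r)%Re by rewrite Ropp_involutive.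
  lra.
apply: contrapT => /forallNP h.
have : is_upper_bound (fun x => E (- x)%Re) (- r)%Re.
  move=> x Ex; apply: Rnot_lt_le => hx; apply: (h (- x)%Re); split=> //; lra.
by move/lub; lra.
Qed.

Lemma leq_INR m n : (m <= n)%N <-> (INR m <= INR n)%Re.
Proof. by split=> [/leP/le_INR|/INR_le/leP]. Qed.

Lemma INR_addn m n : INR (m + n) = (INR m + INR n)%Re.
Proof. exact: plus_INR. Qed.

Lemma INR_muln m n : INR (m * n) = (INR m * INR n)%Re.
Proof. exact: mult_INR. Qed.

Lemma INRS_gt0 n : (0 < INR n.+1)%Re.
Proof. exact/lt_0_INR/Nat.lt_0_succ. Qed.

Lemma INR_lt1 n : (INR n < 1)%Re -> n = 0%N.
Proof. by move=> h; apply/eqP; rewrite -leqn0 -ltnS; apply/ltP/INR_lt. Qed.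

Lemma pow_half_gt0 k : (0 < (/ 2) ^ k)%Re.
Proof. by apply: pow_lt; lra. Qed.

Lemma pow_half_small e : (0 < e)%Re -> exists k, ((/ 2) ^ k < e)%Re.
Proof.
move=> e0; have [|N hN] := pow_lt_1_zero (/ 2) _ e e0; first by rewrite Rabs_pos_eq; lra.
exists N; have := hN N (le_n N); rewrite Rabs_pos_eq //.
exact/Rlt_le/pow_half_gt0.
Qed.

Lemma pow_half_INR n k : (n <= k)%N -> ((/ 2) ^ k * INR n < 1)%Re.
Proof.
move=> nk; have : (INR k < 2 ^ k)%Re.
  elim: k {nk} => [|k IH]; first by rewrite /=; lra.
  rewrite S_INR /=; have : (1 <= 2 ^ k)%Re by apply: pow_R1_Rle; lra.
  lra.
have /leq_INR := nk; rewrite pow_inv => h1 h2.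
have h0 : (0 < 2 ^ k)%Re by apply: pow_lt; lra.
apply: (Rmult_lt_reg_l (2 ^ k)) => //.
by rewrite -Rmult_assoc Rinv_r; lra.
Qed.

Lemma absz_leD (x y : int) : (`|(x + y)%R| <= `|x| + `|y|)%N.
Proof. by rewrite -lez_nat PoszD !abszE Num.Theory.ler_normD. Qed.

(** Completeness need only be tested on rapidly converging series: pass to a subsequence of the
    Cauchy sequence and telescope. *)
Lemma norm_complete_of_series (S : zmodType) (N : S -> R) (hN : group_norm N) :
  (forall dl : nat -> S, (forall k, (N (dl k) < (/ 2) ^ k)%Re) ->
     exists l, forall K, (N (l - \sum_(0 <= k < K) dl k)%R <= 2 * (/ 2) ^ K)%Re) ->
  metric_complete (G := norm_topgroup hN) (fun x y : S => N (x - y)).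
Proof.
have [N0 NN NT _] := hN.
move=> ser s cs.
have /choice [g hg] k := cs _ (pow_half_gt0 k).
(* The running maximum makes the chosen indices nondecreasing. *)
pose n k := (\max_(j < k.+1) g j)%N.
have gn k : (g k <= n k)%N by exact: (leq_bigmax (ord_max : 'I_k.+1)).
have nS k : (n k <= n k.+1)%N by rewrite /n [X in (_ <= X)%N]big_ord_recr leq_maxl.
have [|l hl] := ser (fun k => (s (n k.+1) : S) - s (n k)).
  by move=> k; apply: hg; rewrite ?gn // (leq_trans (gn k)).
exists ((l + s (n 0%N)) : S) => e e0.
have [|K hK] := @pow_half_small (e / 3)%Re; first lra.
exists (n K) => m hm.
have h1 := hg K m (n K) (leq_trans (gn K) hm) (gn K).
have h2 := hl K; rewrite telescope_sumr // in h2.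
have split_diff (p q r t : S) : p - (t + r) = p - q + - (t - (q - r)).
  by rewrite !opprB opprD !addrA subrK addrAC.
rewrite (split_diff _ (s (n K))); apply: Rle_lt_trans (NT _ _) _; rewrite NN.
have -> : e = (e / 3 + 2 * (e / 3))%Re by lra.
apply: Rplus_lt_compat; first exact: Rlt_trans h1 hK.
by apply: Rle_lt_trans h2 _; lra.
Qed.

Section PolishSubgroup.
Variable H : zmodType.
Hypotheses (tf : torsion_free H) (zs : zadic_separated H).
Variable h : nat -> H.
Hypothesis h_neq0 : forall n, h n <> 0.
Hypothesis h_sum : forall a : nat -> nat, (forall n, (a n <= n.+1)%N) ->
  exists x : H, forall N, exists g,
    x = \sum_(0 <= n < N) h n *+ a n *+ n`! + g *+ N`!.

Implicit Types (a b c : nat -> int) (x y : H).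

(* x is the value of the formal series \sum_n n! a_n h_n in the Z-adic topology. *)
Definition expands a x : Prop :=
  forall N, exists g, x = \sum_(0 <= n < N) h n *~ a n *+ n`! + g *+ N`!.

Definition null_growth a : Prop :=
  forall k, exists M, forall n, (M <= n)%N -> (k * `|a n| <= n.+1)%N.

Definition growth_le a (r : R) : Prop :=
  forall n, (INR `|a n| <= r * INR n.+1)%Re.

Lemma expands0 : expands (fun=> 0) 0.
Proof. by move=> N; exists 0; rewrite mul0rn addr0 big1 // => i _; rewrite mulr0z mul0rn. Qed.

Lemma expandsD a b x y : expands a x -> expands b y ->
  expands (fun n => a n + b n) (x + y).
Proof.
move=> ha hb N; have [g ->] := ha N; have [g' ->] := hb N; exists (g + g').
rewrite addrACA -mulrnDl; congr (_ + _); rewrite -big_split /=.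
by apply: eq_bigr => i _; rewrite -mulrnDl mulrzDr.
Qed.

Lemma expandsN a x : expands a x -> expands (fun n => - a n) (- x).
Proof.
move=> ha N; have [g ->] := ha N; exists (- g).
rewrite opprD -mulNrn -sumrN; congr (_ + _).
by apply: eq_bigr => i _; rewrite -mulNrn mulrNz.
Qed.

Lemma expandsB a b x y : expands a x -> expands b y ->
  expands (fun n => a n - b n) (x - y).
Proof. by move=> ha /expandsN; exact: expandsD. Qed.

Lemma expands_finite a M : (forall n, (M <= n)%N -> a n = 0) ->
  expands a (\sum_(0 <= n < M) h n *~ a n *+ n`!).
Proof.
move=> ha N; have [MN|NM] := leqP M N.
  exists 0; rewrite mul0rn addr0 (big_cat_nat (leq0n M) MN) /=.
  rewrite [X in _ = _ + X]big1_seq ?addr0 // => i /=; rewrite mem_index_iota => /andP [Mi _].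
  by rewrite ha // mulr0z mul0rn.
rewrite (big_cat_nat (leq0n N) (ltnW NM)) /=.
suff [g ->] : exists g, \sum_(N <= n < M) h n *~ a n *+ n`! = g *+ N`! by exists g.
rewrite big_seq; apply: (big_ind (fun y => exists g, y = g *+ N`!)).
- by exists 0; rewrite mul0rn.
- by move=> _ _ [g ->] [g' ->]; exists (g + g'); rewrite mulrnDl.
move=> i; rewrite mem_index_iota => /andP [Ni _].
(* The falling factorial is the quotient of [i!] by [N!]. *)
exists (h i *~ a i *+ i ^_ (i - N)).
by have := ffact_fact (leq_subr N i); rewrite subKn // => e; rewrite -mulrnA e.
Qed.

Lemma null_growthD a b : null_growth a -> null_growth b -> null_growth (fun n => a n + b n).
Proof.
move=> ha hb k; have [M hM] := ha (k + k)%N; have [M' hM'] := hb (k + k)%N.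
exists (maxn M M') => n; rewrite geq_max => /andP [/hM h1 /hM' h2].
have h3 : (k * `|(a n + b n)%R| <= k * `|a n| + k * `|b n|)%N.
  by rewrite -mulnDr leq_mul2l absz_leD orbT.
have := leq_add h1 h2; rewrite !mulnDl addnACA !addnn leq_double.
exact: leq_trans h3.
Qed.

Lemma null_growthN a : null_growth a -> null_growth (fun n => - a n).
Proof. by move=> ha k; have [M hM] := ha k; exists M => n; rewrite abszN; exact: hM. Qed.

Lemma null_growthB a b : null_growth a -> null_growth b -> null_growth (fun n => a n - b n).
Proof. by move=> ha /null_growthN; exact: null_growthD. Qed.

Lemma null_growth_finite a M : (forall n, (M <= n)%N -> a n = 0) -> null_growth a.
Proof. by move=> ha k; exists M => n /ha ->; rewrite muln0. Qed.

Lemma growth_leD a b r r' : growth_le a r -> growth_le b r' ->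
  growth_le (fun n => a n + b n) (r + r')%Re.
Proof.
move=> ha hb n; have := ha n; have := hb n.
by have /leq_INR := absz_leD (a n) (b n); rewrite INR_addn; lra.
Qed.

Lemma growth_leN a r : growth_le a r -> growth_le (fun n => - a n) r.
Proof. by move=> ha n; rewrite abszN. Qed.

Lemma growth_le_mono a r r' : (r <= r')%Re -> growth_le a r -> growth_le a r'.
Proof.
move=> rr ha n; apply: Rle_trans (ha n) _; apply: Rmult_le_compat_r => //.
exact/Rlt_le/INRS_gt0.
Qed.

(** An integer of absolute value at most (i + 1) / (n + 1) < 1 is 0. This turns small norm into
    divisibility by a large factorial. *)
Lemma growth_le_eq0 a n i : growth_le a (/ INR n.+1) -> (i < n)%N -> a i = 0.
Proof.
move=> ha hi; apply/eqP; rewrite -absz_eq0; apply/eqP/INR_lt1.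
apply: Rle_lt_trans (ha i) _.
have : (INR i.+1 < INR n.+1)%Re by apply: lt_INR; apply/ltP.
have := INRS_gt0 n => p lt; apply: (Rmult_lt_reg_l (INR n.+1)) => //.
by rewrite -Rmult_assoc Rinv_r; lra.
Qed.

Lemma null_growth_bounded a : null_growth a -> exists r, (0 <= r)%Re /\ growth_le a r.
Proof.
move=> ha; have [M hM] := ha 1%N.
exists (1 + INR (\sum_(0 <= n < M) `|a n|))%Re; split.
  by have := pos_INR (\sum_(0 <= n < M) `|a n|); lra.
move=> n; have p := INRS_gt0 n.
have q := pos_INR (\sum_(0 <= n < M) `|a n|).
have [/hM|lt] := leqP M n; first by rewrite mul1n => /leq_INR; nra.
have : (`|a n| <= \sum_(0 <= n < M) `|a n|)%N.
  by rewrite big_mkord (bigD1 (Ordinal lt)) //= leq_addr.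
move/leq_INR; have : (1 <= INR n.+1)%Re by rewrite S_INR; have := pos_INR n; lra.
nra.
Qed.

(** The hypothesis [h_sum] accepts only natural digits at most [n + 1]. From some [M] on, the
    positive and negative parts of [a] are such digits; the finite head is summed directly. *)
Lemma expands_exists a : null_growth a -> exists x, expands a x.
Proof.
move=> ha; have [M hM] := ha 1%N.
pose p n := if (M <= n)%N then (if a n is Posz k then k else 0%N) else 0%N.
pose q n := if (M <= n)%N then (if a n is Negz k then k.+1 else 0%N) else 0%N.
pose c n := if (M <= n)%N then 0 else a n.
have [|x hx] := @h_sum p.
  by move=> n; rewrite /p; case: (leqP M n) => // /hM; rewrite mul1n; case: (a n).
have [|y hy] := @h_sum q.
  by move=> n; rewrite /q; case: (leqP M n) => // /hM; rewrite mul1n; case: (a n).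
have hc : expands c (\sum_(0 <= n < M) h n *~ c n *+ n`!).
  by apply: expands_finite => n Mn; rewrite /c Mn.
have hx' : expands (fun n => Posz (p n)) x by [].
have hy' : expands (fun n => Posz (q n)) y by [].
have := expandsD (expandsB hx' hy') hc.
set z := (X in expands _ X); move=> hz; exists z; move: hz; congr expands.
apply: funext => n; rewrite /p /q /c; case: leqP => _; last by rewrite subrr add0r.
by case: (a n) => k; rewrite addr0 ?subr0 // sub0r NegzE.
Qed.

Definition series_values x : Prop := exists2 a, null_growth a & expands a x.

Lemma series_values_subgroup : add_subgroup series_values.
Proof.
split.
- by exists (fun=> 0); [apply: (@null_growth_finite _ 0%N)|exact: expands0].
- move=> x y [a na ea] [b nb eb]; exists (fun n => a n + b n); first exact: null_growthD.
  exact: expandsD.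
- by move=> x [a na ea]; exists (fun n => - a n); [exact: null_growthN|exact: expandsN].
Qed.

Definition value_zmod : zmodType := sub_zmod series_values_subgroup.
Definition value : value_zmod -> H := @sub_val _ _ series_values_subgroup.

Implicit Types (u v : value_zmod).

Lemma valueP u : series_values (value u). Proof. exact: sub_valP. Qed.
Lemma value_surj x : series_values x -> exists u, value u = x.
Proof. exact: sub_val_surj. Qed.

(** The quotient norm: the infimum of the growth rates over all expansions of [u], described by its
    two defining properties. *)
Lemma value_norm_ex : exists N : value_zmod -> R, forall u,
  (forall r a, (0 <= r)%Re -> null_growth a -> expands a (value u) -> growth_le a r ->
     (N u <= r)%Re) /\
  (forall r, (N u < r)%Re -> exists a,
     [/\ null_growth a, expands a (value u) & growth_le a r]) /\ (0 <= N u)%Re.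
Proof.
suff /choice [N hN] : forall u, exists m, 
  (forall r a, (0 <= r)%Re -> null_growth a -> expands a (value u) -> growth_le a r ->
     (m <= r)%Re) /\
  (forall r, (m < r)%Re -> exists a,
     [/\ null_growth a, expands a (value u) & growth_le a r]) /\ (0 <= m)%Re.
  by exists N.
move=> u; pose E r := (0 <= r)%Re /\ exists a,
  [/\ null_growth a, expands a (value u) & growth_le a r].
have [||m [h1 h2]] := @real_inf E.
- have [a na ea] := valueP u; have [r [r0 hr]] := null_growth_bounded na.
  by exists r; split=> //; exists a.
- by move=> r [].
exists m; split; first by move=> r a r0 na ea ga; apply: h1; split=> //; exists a.
split; last by apply: Rnot_lt_le => /h2 [r [[r0 _]]]; lra.
move=> r /h2 [r' [[_ [a [na ea ga]]] lt]]; exists a; split=> //.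
by apply: growth_le_mono ga; lra.
Qed.

Definition value_norm : value_zmod -> R := projT1 (cid value_norm_ex).

Lemma value_norm_le u r a : (0 <= r)%Re -> null_growth a -> expands a (value u) ->
  growth_le a r -> (value_norm u <= r)%Re.
Proof. by rewrite /value_norm; case: cid => N /= /(_ u) [hN _]; exact: hN. Qed.

Lemma value_norm_lt u r : (value_norm u < r)%Re -> exists a,
  [/\ null_growth a, expands a (value u) & growth_le a r].
Proof. by rewrite /value_norm; case: cid => N /= /(_ u) [_ [hN _]]; exact: hN. Qed.

Lemma value_norm_ge0 u : (0 <= value_norm u)%Re.
Proof. by rewrite /value_norm; case: cid => N /= /(_ u) [_ []]. Qed.

Lemma value_group_norm : group_norm value_norm.
Proof.
have NN u : (value_norm (- u) <= value_norm u)%Re.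
  apply: le_epsilon => e e0; have := value_norm_ge0 u => p.
  have [|a [na ea ga]] := @value_norm_lt u (value_norm u + e)%Re; first lra.
  apply: (value_norm_le _ (null_growthN na)); [lra|exact: expandsN|exact: growth_leN].
split.
- apply: Rle_antisym; last exact: value_norm_ge0.
  apply: (@value_norm_le _ _ (fun=> 0)); first lra.
  + exact: (@null_growth_finite _ 0%N).
  + exact: expands0.
  + by move=> n; rewrite absz0 Rmult_0_l; exact: Rle_refl.
- by move=> u; apply: Rle_antisym => //; rewrite -{1}(opprK u).
- move=> u v; apply: le_epsilon => e e0.
  have pu := value_norm_ge0 u; have pv := value_norm_ge0 v.
  have [|a [na ea ga]] := @value_norm_lt u (value_norm u + e / 2)%Re; first lra.
  have [|b [nb eb gb]] := @value_norm_lt v (value_norm v + e / 2)%Re; first lra.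
  apply: (value_norm_le _ (null_growthD na nb)); [lra|exact: expandsD|].
  by apply: growth_le_mono (growth_leD ga gb); lra.
(* Norm 0 gives, for each [n], an expansion whose first [n] coefficients vanish, so the value is
   divisible by every [n!]. *)
- move=> u u0; apply: sub_val_inj; rewrite sub_val0 -[sub_val u]/(value u); apply: zs => n.
  have [|a [na ea ga]] := @value_norm_lt u (/ INR n.+1)%Re.
    by rewrite u0; exact: invINR_gt0.
  have [g ->] := ea n; exists g; rewrite big1_seq ?add0r // => i /=.
  by rewrite mem_index_iota => /andP [_ hi]; rewrite (growth_le_eq0 ga hi) mulr0z mul0rn.
Qed.

Definition value_topgroup : topgroup := norm_topgroup value_group_norm.

Fixpoint partial_coefs (A : nat -> nat -> int) K n : int :=
  if K is k.+1 then partial_coefs A k n + A k n else 0.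

Lemma partial_coefs_tail (A : nat -> nat -> int) :
  (forall k, growth_le (A k) ((/ 2) ^ k)) -> forall K j,
  growth_le (fun n => partial_coefs A (K + j) n - partial_coefs A K n)
    (2 * (/ 2) ^ K - 2 * (/ 2) ^ (K + j))%Re.
Proof.
move=> hA K; elim=> [|j IH].
  move=> n; rewrite addn0 subrr absz0; have := INRS_gt0 n => p /=; lra.
rewrite addnS /=; have := growth_leD IH (hA (K + j)%N).
set r := (X in growth_le _ X); set r' := (X in _ -> growth_le _ X).
have -> : r = r' by rewrite /r /r'; lra.
by congr growth_le; apply: funext => n; rewrite addrAC.
Qed.

(* A series with rapidly decreasing terms is summed coefficientwise: each coefficient
   is a finite sum, because integers of absolute value below 1 vanish. *)
Lemma value_series (dl : nat -> value_zmod) :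
  (forall k, (value_norm (dl k) < (/ 2) ^ k)%Re) ->
  exists l, forall K, (value_norm (l - \sum_(0 <= k < K) dl k)%R <= 2 * (/ 2) ^ K)%Re.
Proof.
move=> hd.
have /choice [A hA] k := value_norm_lt (hd k).
have gA k : growth_le (A k) ((/ 2) ^ k) by have [] := hA k.
pose s := partial_coefs A.
(* Coefficient [n] is final at stage [n + 1]: for later [k], the increment is at most (n + 1) / 2^k
   < 1. *)
pose a n := s n.+1 n.
have aE K n : a n = s (K + n.+1)%N n.
  have stab j : s (n.+1 + j)%N n = s n.+1 n.
    elim: j => [|j IH]; first by rewrite addn0.
    rewrite addnS -[s _.+1 n]/(s (n.+1 + j)%N n + A (n.+1 + j)%N n) IH.
    suff -> : A (n.+1 + j)%N n = 0 by rewrite addr0.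
    apply/eqP; rewrite -absz_eq0; apply/eqP/INR_lt1; apply: Rle_lt_trans (gA _ n) _.
    by apply: pow_half_INR; exact: leq_addr.
  by rewrite /a addnC stab.
have tail K : growth_le (fun n => a n - s K n) (2 * (/ 2) ^ K)%Re.
  move=> n; rewrite (aE K); apply: Rle_trans (partial_coefs_tail gA K n.+1 n) _.
  apply: Rmult_le_compat_r; first exact/Rlt_le/INRS_gt0.
  by have := pow_half_gt0 (K + n.+1); lra.
have ns K : null_growth (s K).
  elim: K => [|K IH]; first exact: (@null_growth_finite _ 0%N).
  by apply: null_growthD => //; have [] := hA K.
have es K : expands (s K) (value (\sum_(0 <= k < K) dl k)).
  elim: K => [|K IH]; first by rewrite big_nil; exact: expands0.
  rewrite big_nat_recr //.
  by apply: (expandsD (y := value (dl K)) IH); have [] := hA K.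
(* Half of the allowance [n + 1] goes to the tail beyond [K], whence the factor 4 in the choice of
   [K], and half to the partial sum [s K], whence the multiplier [2 * k]. *)
have na : null_growth a.
  move=> k; have k1 := INRS_gt0 k.
  have [|K hK] := @pow_half_small (/ (4 * INR k.+1))%Re.
    by apply: Rinv_0_lt_compat; lra.
  have [M hM] := ns K (2 * k)%N; exists M => n /hM /leq_INR.
  rewrite !INR_muln => h1; apply/leq_INR; rewrite INR_muln.
  have := tail K n; have /leq_INR := absz_leD (a n - s K n) (s K n).
  rewrite subrK INR_addn => h2 h3.
  have n1 := INRS_gt0 n; have k0 := pos_INR k.
  have h4 : (4 * INR k.+1 * (/ 2) ^ K < 1)%Re.
    have := Rmult_lt_compat_l (4 * INR k.+1) _ _ (ltac:(lra)) hK.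
    by rewrite Rinv_r; lra.
  have h5 : (INR k * INR `|(a n - s K n)%R| <= INR k * (2 * (/ 2) ^ K * INR n.+1))%Re.
    exact: Rmult_le_compat_l.
  have h6 : (INR k * INR `|a n| <= INR k * (INR `|(a n - s K n)%R| + INR `|s K n|))%Re.
    exact: Rmult_le_compat_l.
  have h7 : (4 * INR k * (/ 2) ^ K <= 1)%Re.
    by rewrite S_INR in h4; have := pow_half_gt0 K; lra.
  have h8 : (4 * INR k * (/ 2) ^ K * INR n.+1 <= 1 * INR n.+1)%Re.
    by apply: Rmult_le_compat_r => //; lra.
  have h9 : (INR 2 = 2)%Re by [].
  rewrite h9 in h1; lra.
have [x ex] := expands_exists na.
have [l hl] := value_surj (ex_intro2 _ _ a na ex).
exists l => K; apply: (value_norm_le _ (null_growthB na (ns K))) (tail K).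
  by have := pow_half_gt0 K; lra.
by rewrite -hl in ex; exact: (expandsB ex (es K)).
Qed.

(** Finite integer sequences are countable, and truncating an expansion far enough leaves a
    remainder of small growth because the growth is null. *)
Lemma value_separable : separable value_topgroup.
Proof.
have fin (t : seq int) : exists u, value u = \sum_(0 <= n < size t) h n *~ nth 0 t n *+ n`!.
  apply: value_surj; exists (fun n => nth 0 t n).
    by apply: (@null_growth_finite _ (size t)) => n; exact: nth_default.
  by apply: expands_finite => n; exact: nth_default.
have /choice [w hw] := fin.
exists (fun i => if unpickle i is Some t then w t else 0) => U oU [u Uu].
have [e [e0 he]] := oU u Uu.
have [a na ea] := valueP u.
have [k hk] := invINR_small e0.
have [M hM] := na k.+1.
exists (pickle (mkseq a M)); rewrite pickleK; apply: he; apply: Rle_lt_trans hk.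
pose c n := nth 0 (mkseq a M) n.
have cM n : (M <= n)%N -> c n = 0 by move=> Mn; rewrite /c nth_default // size_mkseq.
have ec : expands c (value (w (mkseq a M))).
  by rewrite hw size_mkseq; exact: expands_finite cM.
apply: (value_norm_le _ (null_growthB na (null_growth_finite cM))).
- exact/Rlt_le/invINR_gt0.
- exact: expandsB.
- move=> n; have n1 := INRS_gt0 n; have k1 := INRS_gt0 k; have ki := invINR_gt0 k.
  have [Mn|nM] := leqP M n; last first.
    rewrite /c nth_mkseq // subrr absz0; have := Rmult_lt_0_compat _ _ ki n1; rewrite /=; lra.
  rewrite cM // subr0; have /leq_INR := hM n Mn; rewrite INR_muln => h1.
  apply: (Rmult_le_reg_l (INR k.+1)) => //.
  by rewrite -Rmult_assoc Rinv_r; lra.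
Qed.

(** The elements [n!] times [h n] have norm at most 1 / (n + 1) and are nonzero by
    torsion-freeness. *)
Lemma value_not_discrete : ~ discrete value_topgroup.
Proof.
move=> /(_ (fun u => u = 0)) o0; have [e [e0 he]] := o0 (0 : value_zmod) erefl.
have [n hn] := invINR_small e0.
pose a i : int := if i == n then 1 else 0.
have a0 i : (n.+1 <= i)%N -> a i = 0 by rewrite /a; case: eqP => // ->; rewrite ltnn.
have na := null_growth_finite a0; have ea := expands_finite a0.
have [u hu] := value_surj (ex_intro2 _ _ a na ea).
have sumE : \sum_(0 <= i < n.+1) h i *~ a i *+ i`! = h n *+ n`!.
  rewrite big_nat_recr //= /a eqxx mulr1z big1_seq ?add0r // => i /=.
  rewrite mem_index_iota => /andP [_ hi].
  by case: eqP hi => [->|_ _]; [rewrite ltnn|rewrite mulr0z mul0rn].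
have : u = 0.
  apply: he; have [_ NN _ _] := value_group_norm.
  rewrite sub0r NN; apply: Rle_lt_trans hn.
  apply: (value_norm_le _ na); first exact/Rlt_le/invINR_gt0.
    by rewrite hu.
  move=> i; rewrite /a; case: eqP => [->|_].
    by rewrite Rinv_l; [exact: Rle_refl|have := INRS_gt0 n; lra].
  rewrite absz0; have := Rmult_lt_0_compat _ _ (invINR_gt0 n) (INRS_gt0 i); rewrite /=; lra.
move=> u0; apply: (h_neq0 (n := n)); apply: (tf (fact_gt0 n)).
by rewrite -sumE -hu u0.
Qed.

Lemma series_polish_subgroup : ~ no_nondiscrete_polish_subgroup H.
Proof.
apply; exists value_topgroup, value; split.
  split; last exact: value_separable.
  apply: norm_completely_metrizable; apply: norm_complete_of_series.
  exact: value_series.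
split; first exact: value_not_discrete.
by split=> // u v; exact: sub_val_inj.
Qed.

End PolishSubgroup.

Lemma cm_slender_sufficient H : torsion_free H -> reduced H ->
  no_nondiscrete_polish_subgroup H -> cm_slender H.
Proof.
move=> tf red np G [d [dm [di dc]]] f hf; apply: contrapT => nk.
have [x [fx hx]] := exists_nested_roots dm di dc hf nk.
apply: (series_polish_subgroup tf (zadic_separated_of_reduced tf red)
  (h := fun n => f (x n))) np => //.
move=> a /hx [z hz]; exists (f (z 0%N)) => N; exists (f (z N)).
by rewrite big_mkord; exact: (factorial_expansion hf hz).
Qed.

(** * Homomorphic images of compact abelian groups *)

Definition no_compact_image (H : zmodType) : Prop :=
  forall C : topgroup, tg_commutative C -> compact (fun _ : C => True) -> hausdorff C ->
  forall r : C -> H, ghom r -> forall c, r c = 0.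

(** A compact group is a summand of itself, so its image in [H] is a cotorsion subgroup. *)
Lemma cotorsion_free_no_compact_image H : cotorsion_free H -> no_compact_image H.
Proof.
move=> cf C cC kC hC r hr c.
pose S (x : H) := exists c, r c = x.
have hS : add_subgroup S.
  split; first by exists (tg_one C); exact: ghom1.
    by move=> _ _ [a <-] [b <-]; exists (a ** b).
  by move=> _ [a <-]; exists (tg_inv a); exact: ghomV.
have /choice [f hf] : forall a, exists u, sub_val (hS := hS) u = r a.
  by move=> a; apply: sub_val_surj; exists a.
have fD (a b : tg_zmod cC) : f (a + b) = f a + f b.
  by apply: sub_val_inj; rewrite sub_valD !hf; exact: hr.
rewrite -hf; suff cot : cotorsion (sub_zmod hS).
  by have -> := cf _ _ (@sub_valD _ _ hS) (@sub_val_inj _ _ hS) cot (f c).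
exists (tg_zmod cC), f; split; first by exists C, id, id.
split=> // u; have [a ea] := sub_valP u.
by exists a; apply: sub_val_inj; rewrite hf.
Qed.

(* Z/n!, written with .-1.+1 because only 'I_k.+1 carries the additive structure. *)
Definition fact_prod : nat -> zmodType := fun n => 'I_(n`!).-1.+1.
Notation fact_group := (dprod_topgroup fact_prod).
Definition fact_unit : dprod fact_prod := fun n => inZp 1 : 'I_(n`!).-1.+1.
Definition fact_coord (u : dprod fact_prod) n : nat := (coord u n : 'I_(n`!).-1.+1).

Lemma fact_coord_lt u n : (fact_coord u n < n`!)%N.
Proof.
rewrite -[X in (_ < X)%N](prednK (fact_gt0 n)).
exact: (ltn_ord (coord u n : 'I_(n`!).-1.+1)).
Qed.

Lemma fact_coordD u v n : fact_coord (u + v) n = ((fact_coord u n + fact_coord v n) %% n`!)%N.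
Proof. by rewrite -[X in (_ %% X)%N](prednK (fact_gt0 n)). Qed.

Lemma fact_coordMn k n : fact_coord (fact_unit *+ k) n = (k %% n`!)%N.
Proof.
rewrite /fact_coord coordMn.
have -> : (coord fact_unit n : 'I_(n`!).-1.+1) *+ k = inZp k.
  by rewrite Zp_mulrn; apply: val_inj; rewrite /= modnMml mul1n.
by rewrite /= prednK ?fact_gt0.
Qed.

Lemma fact_group_compact : compact (fun _ : fact_group => True).
Proof.
apply: dprod_compact => n; exists (enum 'I_(n`!).-1.+1) => t.
by apply: In_mem; rewrite mem_enum.
Qed.

Lemma fact_group_hausdorff : hausdorff fact_group.
Proof. exact/hausdorff_metrizable/dprod_completely_metrizable. Qed.

Lemma mulrn_modn (H : zmodType) (x : H) n N :
  exists g, x *+ n = x *+ (n %% N) + g *+ N.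
Proof.
exists (x *+ (n %/ N)); rewrite -mulrnA -mulrnDr; congr (x *+ _).
by rewrite {1}(divn_eq n N) addnC.
Qed.

(** If [x] has order dividing [m], multiplying it by the residue modulo [(m + 1)!] is a homomorphism
    on the compact product that takes the unit to [x]. *)
Lemma no_compact_image_torsion_free H : no_compact_image H -> torsion_free H.
Proof.
move=> nc x m m0 xm.
have xf k : x *+ (k %% (m.+1)`!) = x *+ k.
  rewrite {2}(divn_eq k (m.+1)`!) mulrnDr.
  have /dvdnP [q ->] : (m %| (m.+1)`!)%N by rewrite dvdn_fact // m0 leqnSn.
  by rewrite mulnA (mulrnA x _ m) mulrnAC xm mul0rn add0r.
have := nc fact_group (@dprod_commutative _) fact_group_compact fact_group_hausdorff
  (fun u => x *+ fact_coord u m.+1) _ (fact_unit *+ 1).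
rewrite fact_coordMn xf mulr1n; apply=> u v.
by rewrite -mulrnDr -[RHS]xf -fact_coordD.
Qed.

Lemma leq_fact n : (n <= n`!)%N.
Proof. by case: n => // n; rewrite factS leq_pmulr ?fact_gt0. Qed.

(** The unit of the compact product has infinite order, so sending it to 1 extends to a homomorphism
    into the injective group [rat]; composed with a copy of [rat] in [H], this is a nonzero compact
    image. *)
Lemma no_compact_image_reduced H : no_compact_image H -> reduced H.
Proof.
move=> nc [j [jD jI]].
pose g0 : set (dprod fact_prod * rat) := fun p => exists k : int,
  p = (fact_unit *~ k, k%:~R).
have e_inj m : fact_unit *+ m = 0 -> m = 0%N.
  move=> /(congr1 (fun u => fact_coord u m.+1)); rewrite fact_coordMn modn_small //.
  exact: leq_trans (ltnSn m) (leq_fact m.+1).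
have [|phi [phiD phi0]] := @hom_extension _ _ g0 (@ext_rat _).
  split; first by exists 0; rewrite mulr0z.
    by move=> _ _ [k ->] [l ->]; exists (k - l); rewrite mulrzBr rmorphB.
  move=> d [k [e ->]]; suff -> : k = 0 by [].
  case: k e => m; rewrite ?NegzE ?mulrNz -?pmulrn; first by move=> /esym /e_inj ->.
  by move=> /esym /eqP; rewrite oppr_eq0 => /eqP /e_inj.
have j0 : j 0 = 0 by apply: (addrI (j 0)); rewrite -jD !addr0.
have := nc fact_group (@dprod_commutative _) fact_group_compact fact_group_hausdorff
  (fun u => j (phi u)) _ fact_unit.
rewrite (phi0 _ 1); last by exists 1; rewrite mulr1z.
rewrite -j0; move=> h; have /jI /eqP : j 1 = j 0 by apply: h => u v; rewrite phiD jD.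
by rewrite oner_eq0.
Qed.

(** * Nested roots in locally compact groups *)

Section UltraLimit.
Variables (G : topgroup) (I : Type) (F : set_system I).
Implicit Types (s t : I -> G) (l : G).

Definition ulim s l : Prop := forall U, tg_open U -> U l -> F (fun i => U (s i)).

(** Without a limit, [K] is covered by finitely many open sets that [s] does not enter along [F]; an
    ultrafilter contains all their complements, hence the empty set. *)
Lemma ulim_compact s K : UltraFilter F -> compact K -> F (fun i => K (s i)) ->
  exists l, ulim s l.
Proof.
move=> uF cK FK; apply: contrapT => /forallNP h.
have pF : ProperFilter F by case: uF.
have [||L [LC Lc]] := cK (fun U => tg_open U /\ ~ F (fun i => U (s i))).
- by move=> U [].
- move=> x _; have := h x; rewrite /ulim => /existsNP [U /not_implyP [oU /not_implyP [Ux nU]]].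
  by exists U.
have : F (fun i => exists U, List.In U L /\ U (s i)) by apply: filterS FK => i /Lc.
elim: L LC {Lc} => [_|U L IH LC] FL.
  by have [i [V []]] := filter_ex FL.
have [_ nU] := LC U (or_introl erefl).
have [//|FU] := in_ultra_setVsetC (fun i => U (s i)) uF.
apply: IH; first by move=> V VL; apply: LC; right.
apply: filterS (filterI FL FU) => i [[V [[<-|VL] Vi]] nUi] //.
by exists V.
Qed.

Lemma ulim_uniq s l l' : ProperFilter F -> hausdorff G -> ulim s l -> ulim s l' -> l = l'.
Proof.
move=> pF hG sl sl'; apply: contrapT => /hG [U [V [oU [oV [Ul [Vl' UV]]]]]].
by have [i [Ui Vi]] := filter_ex (filterI (sl _ oU Ul) (sl' _ oV Vl')); exact: UV Ui Vi.
Qed.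

Lemma ulim_continuous g s l : tg_continuous g -> ulim s l -> ulim (fun i => g (s i)) (g l).
Proof. by move=> cg sl U oU Ul; exact: sl (cg _ oU) Ul. Qed.

Lemma ulim_mul s t l l' : Filter F -> ulim s l -> ulim t l' ->
  ulim (fun i => s i ** t i) (l ** l').
Proof.
move=> fF sl tl U oU Ul; have [V [W [oV [oW [Vl [Wl h]]]]]] := tg_mul_cont oU Ul.
by apply: filterS (filterI (sl _ oV Vl) (tl _ oW Wl)) => i [? ?]; exact: h.
Qed.

Lemma ulim_eq s t l : Filter F -> F (fun i => s i = t i) -> ulim s l -> ulim t l.
Proof.
by move=> fF e sl U oU Ul; apply: filterS (filterI e (sl _ oU Ul)) => i [<-].
Qed.

End UltraLimit.

Section NestedCompact.
Variables (G : topgroup) (H : zmodType) (f : G -> H) (h : H).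
Hypotheses (hG : hausdorff G) (lG : locally_compact G) (hf : ghom f).
Hypothesis near_h : forall W, tg_open W -> W (tg_one G) -> exists y, W y /\ f y = h.

(** The pair is the generator [y n] and the next neighbourhood. The last clause keeps every word
    starting at [n] inside [W], hence in one compact set; no metric estimate is involved. *)
Definition shrinking n (W : G -> Prop) (p : G * (G -> Prop)) : Prop :=
  [/\ f p.1 = h, tg_open p.2, p.2 (tg_one G), (forall w, p.2 w -> W w) &
      forall a w, (a <= n.+1)%N -> p.2 w -> W (tg_pow p.1 a ** tg_pow w n.+1)].

Lemma shrink_step n W : tg_open W -> W (tg_one G) -> exists p, shrinking n W p.
Proof.
move=> oW W1; have [V [oV V1 _ VV]] := tg_open_mulM oW W1.
have [||y [hy fy]] := near_h (W := fun y => forall a, (a <= n.+1)%N -> V (tg_pow y a)).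
- by apply: (tg_open_bigcap (P := fun a x => V (tg_pow x a))) => a _; exact: tg_continuous_pow.
- by move=> a _; rewrite tg_pow1.
have V1' : V (tg_pow (tg_one G) n.+1) by rewrite tg_pow1.
exists (y, fun w => W w /\ V (tg_pow w n.+1)); split=> //.
- apply: tg_open_inter => //; exact: (@tg_continuous_pow G n.+1).
- by move=> w [].
- by move=> a w an [_ Vw]; apply: VV => //; exact: hy.
Qed.

Lemma exists_compact_roots : exists y : nat -> G, (forall n, f (y n) = h) /\
  forall a : nat -> nat, (forall n, (a n <= n.+1)%N) ->
  exists z : nat -> G, forall n, z n = tg_pow (y n) (a n) ** tg_pow (z n.+1) n.+1.
Proof.
have [X hX] : exists X : nat -> (G -> Prop) -> G * (G -> Prop), forall n W,
    tg_open W -> W (tg_one G) -> shrinking n W (X n W).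
  suff /choice [X hX] : forall n, exists Xn : (G -> Prop) -> G * (G -> Prop), forall W,
      tg_open W -> W (tg_one G) -> shrinking n W (Xn W) by exists X.
  move=> n; suff /choice [X hX] : forall W : G -> Prop, exists p : G * (G -> Prop),
      tg_open W -> W (tg_one G) -> shrinking n W p by exists X.
  move=> W; have [[oW W1]|nW] := pselect (tg_open W /\ W (tg_one G)).
    by have [p hp] := shrink_step n oW W1; exists p.
  by exists (tg_one G, W) => oW W1; case: nW.
have [O [K [oO [O1 [OK cK]]]]] := lG (tg_one G).
pose W := fix W n : G -> Prop := if n is m.+1 then (X m (W m)).2 else O.
have hW n : tg_open (W n) /\ W n (tg_one G).
  by elim: n => [|n [oW W1]] //=; have [] := hX n _ oW W1.
have WO n x : W n x -> O x.
  elim: n => // n IH; have [oW W1] := hW n; have [_ _ _ sub _] := hX n _ oW W1.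
  by move=> /sub /IH.
pose y n := (X n (W n)).1.
have hy n : f (y n) = h /\ forall a w, (a <= n.+1)%N -> W n.+1 w ->
    W n (tg_pow (y n) a ** tg_pow w n.+1).
  by have [oW W1] := hW n; have [] := hX n _ oW W1.
exists y; split=> [n|a ha]; first by have [] := hy n.
have inW j n : W n (nested_word y a n j (tg_one G)).
  elim: j n => [|j IH] n; first by have [] := hW n.
  by have [_] := hy n; apply.
have [F [uF hF]] := ultraFilterLemma eventually_filter.
have pF : ProperFilter F by case: uF.
(* Words are indexed by a common end [m], so one ultrafilter on [m] serves all [n], and the
   recursion holds between [s n] and [s n.+1] once [m > n]. *)
pose s n m := nested_word y a n (m - n) (tg_one G).
have /choice [z hz] : forall n, exists l, ulim F (s n) l.
  move=> n; apply: ulim_compact cK _; apply: filterS filterT => m _.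
  by apply: OK; apply: WO (inW _ n).
exists z => n; apply: (ulim_uniq pF hG (hz n)).
apply: (@ulim_eq _ _ _ (fun m => tg_pow (y n) (a n) ** tg_pow (s n.+1 m) n.+1)).
  apply: hF; exists n.+1 => // m /= nm.
  by rewrite /s -(subnSK nm).
apply: (ulim_continuous (g := fun w => tg_pow (y n) (a n) ** tg_pow w n.+1)) (hz n.+1).
exact: (tg_continuous_mul (tg_continuous_cst _) (@tg_continuous_pow G n.+1)).
Qed.

Hypotheses (zs : zadic_separated H) (nc : no_compact_image H).

Let e : fact_group := fact_unit.

Lemma fact_pow m : tg_pow e m = fact_unit *+ m.
Proof. by elim: m => //= m ->; rewrite mulrS. Qed.

(** The closure of the integers in the product of all Z/n!, so that compactness is inherited from
    the product. *)
Definition profinite_integers : topgroup := monothetic (@dprod_commutative fact_prod) e.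

(** Up to coordinate [n + 1], [u] agrees with an integer [m - k], whose residues are compatible; [k]
    is moved to the other side to stay in the natural numbers. *)
Lemma profinite_coord (u : dprod fact_prod) n : cyclic_closure e u ->
  (fact_coord u n.+1 %% n`! = fact_coord u n)%N.
Proof.
move=> /(_ (fun v => forall i, (i <= n.+1)%N -> coord v i = coord u i)) [||m [k mk]] //.
  apply/dprod_openP => v hv; exists n.+1 => w hw i hi; by rewrite hw // hv.
have key i : (i <= n.+1)%N -> (fact_coord u i + k = m %[mod i`!])%N.
  move=> /mk; rewrite !fact_pow => hi.
  rewrite -(fact_coordMn m) -[in RHS](subrK (fact_unit *+ k) (fact_unit *+ m)) fact_coordD.
  by rewrite fact_coordMn modnDmr /fact_coord -hi.
have h1 := key n (leqnSn n); have h2 := key n.+1 (leqnn _).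
have h3 : (fact_coord u n.+1 = fact_coord u n %[mod n`!])%N.
  apply/eqP; rewrite -(eqn_modDr k) h1; apply/eqP.
  have dv : (n`! %| n.+1`!)%N by rewrite factS dvdn_mull.
  by rewrite -(modn_dvdm _ dv) h2 modn_dvdm.
by rewrite h3 modn_small // fact_coord_lt.
Qed.

(* Given h, the values \sum_n n! a_n h along factorial digits define a homomorphism from
   the profinite integers to H sending 1 to h. *)
Lemma limit_value_eq0 : h = 0.
Proof.
have [y [fy hy]] := exists_compact_roots.
have val_ex (u : profinite_integers) : exists x : H, forall N, exists g,
    x = h *+ fact_coord (sval u) N + g *+ N`!.
  have hu n := @profinite_coord (sval u) n (svalP u).
  set c := fact_coord (sval u) in hu *.
  (* The factorial digit: the residue modulo [(n + 1)!] is its residue modulo [n!] plus [n!] times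
     this, and it is at most [n]. *)
  pose a n := (c n.+1 %/ n`!)%N.
  have [|z hz] := hy a.
    by move=> n; apply: ltnW; rewrite ltn_divLR ?fact_gt0 // -factS fact_coord_lt.
  exists (f (z 0%N)) => N; exists (f (z N)).
  rewrite (factorial_expansion hf hz N); congr (_ + _).
  elim: N => [|N IH].
    by rewrite big_ord0; have := fact_coord_lt (sval u) 0; rewrite -/c fact0 ltnS leqn0 => /eqP ->.
  rewrite big_ord_recr /= IH fy -mulrnA -mulrnDr addnC; congr (h *+ _).
  by rewrite [RHS](divn_eq _ N`!) hu.
have /choice [phi hphi] := val_ex.
have alg (A B C g g1 g2 g3 : H) n : B + C = A + g3 *+ n ->
    A + g *+ n - (B + g1 *+ n + (C + g2 *+ n)) = (g - (g1 + g2) - g3) *+ n.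
  move=> E; rewrite (addrACA B) E -mulrnDl -[A + g3 *+ n + _]addrA opprD addrACA subrr.
  by rewrite add0r !mulrnBl [g3 *+ n + _]addrC opprD addrA.
(* The values come from arbitrary choices; they are determined, and additive, because congruences
   modulo all [N!] separate points of [H]. *)
have phiD : ghom phi.
  move=> u v; apply/eqP; rewrite -subr_eq0; apply/eqP/zs => N.
  have [g ->] := hphi (u ** v) N; have [g1 ->] := hphi u N; have [g2 ->] := hphi v N.
  have [g3 E] := mulrn_modn h (fact_coord (sval u) N + fact_coord (sval v) N)%N N`!.
  rewrite fact_coordD; exists (g - (g1 + g2) - g3).
  by apply: alg; rewrite -mulrnDr.
pose one : profinite_integers := monothetic_gen (@dprod_commutative fact_prod) e.
have phi1 : phi one = h.
  apply/eqP; rewrite -subr_eq0; apply/eqP/zs => N.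
  have [g ->] := hphi one N; have [g' E] := mulrn_modn h 1 N`!.
  have -> : fact_coord (sval one) N = (1 %% N`!)%N by rewrite -fact_coordMn.
  exists (g - g'); rewrite -[X in _ - X]mulr1n E opprD addrACA subrr add0r.
  by rewrite mulrnBl.
rewrite -phi1; apply: nc phiD _.
- exact/sub_topgroup_commutative/dprod_commutative.
- exact: sub_topgroup_compact fact_group_compact _ (@cyclic_closure_open _ _).
- exact/sub_topgroup_hausdorff/fact_group_hausdorff.
Qed.

End NestedCompact.

(** * Locally compact abelian groups *)

Section ImageTopology.
Variables (G : topgroup) (H : zmodType) (f : G -> H).
Hypothesis hf : ghom f.

(* The group topology on H for which f is an open map onto an open subgroup. *)
Definition image_open (U : H -> Prop) : Prop :=
  forall x, tg_open (fun g => U (x + f g)).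

Lemma image_open_translate x W : tg_open W -> image_open (fun h => exists g, W g /\ h = x + f g).
Proof.
move=> oW y; apply: tg_open_local => g [w [Ww e]].
exists (fun g' => W (w ** (tg_inv g ** g'))); split.
  apply: (tg_continuous_mul (tg_continuous_cst _)) => //.
  exact: (tg_continuous_mul (tg_continuous_cst _) (@tg_continuous_id G)).
rewrite tg_mulVx tg_mulx1; split=> // g' Wg'; exists (w ** (tg_inv g ** g')); split=> //.
by rewrite !hf (ghomV hf) !addrA -e addrK.
Qed.

Definition image_topgroup : topgroup.
Proof.
refine (@TopGroup H +%R 0 -%R image_open (@addrA H) (@add0r H) (@addr0 H)
  (@addNr H) (@addrN H) _ _ _ _ _).
- by move=> x; exact: tg_open_full.
- by move=> U V oU oV x; exact: tg_open_inter.
- move=> F hF x; apply: tg_open_local => g [U [FU Ux]].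
  by exists (fun g => U (x + f g)); split; [exact: hF|split=> // y Uy; exists U].
- move=> U oU x y Uxy.
  have [|V [W [oV [oW [V1 [W1 s]]]]]] := tg_mul_cont (x := tg_one G) (y := tg_one G) (oU (x + y)).
    by rewrite tg_mul1x (ghom1 hf) addr0.
  exists (fun h => exists g, V g /\ h = x + f g), (fun h => exists g, W g /\ h = y + f g).
  split; first exact: image_open_translate.
  split; first exact: image_open_translate.
  split; first by exists (tg_one G); rewrite (ghom1 hf) addr0.
  split; first by exists (tg_one G); rewrite (ghom1 hf) addr0.
  by move=> _ _ [v [Vv ->]] [w [Ww ->]]; rewrite addrACA -hf; exact: s.
- move=> U oU x.
  have -> : (fun g => U (- (x + f g))) = (fun g => U (- x + f (tg_inv g))).
    by apply: funext => g; rewrite (ghomV hf) opprD.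
  exact: tg_inv_cont (oU (- x)).
Defined.

Lemma image_compact K : compact K ->
  compact (G := image_topgroup) (fun h => exists g, K g /\ h = f g).
Proof.
move=> cK C oC cC.
have [||l [lC lc]] := cK (fun V => exists U, C U /\ V = (fun g => U (f g))).
- move=> V [U [CU ->]]; have := oC U CU 0; congr tg_open.
  by apply: funext => g; rewrite add0r.
- move=> g Kg; have [|U [CU Ug]] := cC (f g); first by exists g.
  by exists (fun g => U (f g)); split=> //; exists U.
suff [l' [lC' lc']] : exists l', (forall U, List.In U l' -> C U) /\
    forall V g, List.In V l -> V g -> exists U, List.In U l' /\ U (f g).
  exists l'; split=> // _ [g [/lc [V [Vl Vg]] ->]]; exact: lc' Vl Vg.
elim: l lC {lc} => [|V l IH] lC; first by exists nil; split=> // ? ? [].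
have [|l' [lC' lc']] := IH; first by move=> V' hV; apply: lC; right.
have [U [CU eV]] := lC V (or_introl erefl).
exists (cons U l'); split=> [U' [<-|/lC']|V' g [<-|hV'] Vg] //.
  by exists U; split; [left|rewrite eV in Vg].
by have [U' [Ul Ug]] := lc' _ _ hV' Vg; exists U'; split=> //; right.
Qed.

End ImageTopology.

Section LocallyCompactAbelian.
Variables (T : topgroup) (H : zmodType) (i : T -> H).
Hypotheses (cT : tg_commutative T) (hT : hausdorff T) (hi : ghom i) (inj_i : injective i).
Hypotheses (zs : zadic_separated H) (nc : no_compact_image H).
Variables (O K : T -> Prop).
Hypotheses (oO : tg_open O) (O1 : O (tg_one T)) (OK : forall x, O x -> K x) (cK : compact K).
Hypothesis nd : forall U, tg_open U -> U (tg_one T) -> exists x, U x /\ x <> tg_one T.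

(** The closure of the group generated by [x] lies in [O], hence in [K], and is compact; [i] embeds
    it in [H], where it must be trivial. *)
Lemma bounded_powers_eq1 W W1 x : tg_open W1 -> W1 (tg_one T) ->
  (forall y, W1 y -> W1 (tg_inv y)) -> (forall y z, W1 y -> W1 z -> O (y ** z)) ->
  (forall y, W y -> W (tg_inv y)) -> (forall y z, W y -> W z -> W1 (y ** z)) ->
  (forall n, W (tg_pow x n)) -> x = tg_one T.
Proof.
move=> oW1 W11 sW1 WO sW WW hx; apply: inj_i; rewrite (ghom1 hi).
have clK y : cyclic_closure x y -> K y.
  move=> /(_ (fun t => W1 (tg_inv y ** t))) [||m [n Wmn]].
  - exact: (tg_continuous_mul (tg_continuous_cst _) (@tg_continuous_id T)).
  - by rewrite tg_mulVx.
  apply: OK; have := WO _ _ (WW _ _ (hx m) (sW _ (hx n))) (sW1 _ Wmn).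
  set t := _ ** tg_inv (tg_pow x n); by rewrite tg_invM tg_invK tg_mulA tg_mulxV tg_mul1x.
apply: (nc (C := monothetic cT x) _ _ _ (r := fun u => i (sval u)) _ (monothetic_gen cT x)).
- exact: sub_topgroup_commutative.
- exact: sub_topgroup_compact cK clK (@cyclic_closure_open _ _).
- exact: sub_topgroup_hausdorff.
- by move=> u v; exact: hi.
Qed.

(* Either some x <> 1 has all powers in a small neighbourhood, and generates a compact
   subgroup, or for x -> 1 the first exit powers x ^ N x accumulate at some y <> 1; the
   limits of x ^ (N x / k) are then k-th roots of y. *)
Lemma no_nondiscrete_lca : False.
Proof.
have [W1 [oW1 W11 sW1 WO]] := tg_open_mulM oO O1.
have [W [oW Wone sW WW]] := tg_open_mulM oW1 W11.
have W1K x : W1 x -> K x by move=> h; apply: OK; rewrite -(tg_mulx1 x); exact: WO.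
have exits x : exists N, x <> tg_one T ->
    ~ W (tg_pow x N) /\ forall m, (m < N)%N -> W (tg_pow x m).
  have [->|nx] := pselect (x = tg_one T); first by exists 0%N.
  have ex : exists n, `[< ~ W (tg_pow x n) >].
    apply: contrapT => /forallNP h; apply: nx.
    apply: (bounded_powers_eq1 oW1 W11 sW1 WO sW WW) => n.
    by apply: contrapT => hn; apply: (h n); apply/asboolP.
  exists (ex_minn ex) => _; case: ex_minnP => N /asboolP hN hmin; split=> // m mN.
  apply: contrapT => hm; have := hmin m; rewrite leqNgt mN => h; suff: false by [].
  by apply: h; apply/asboolP.
have /choice [N hN] := exits.
(* The exit power itself is [x] times a power still in [W], so it lies in [W1] and stays in the
   compact set. *)
have inK x m : W x -> x <> tg_one T -> (m <= N x)%N -> K (tg_pow x m).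
  move=> Wx nx; have [nW lt] := hN x nx.
  rewrite leq_eqVlt => /orP [/eqP ->|/lt Wm]; apply: W1K; last first.
    by rewrite -(tg_mulx1 (tg_pow x m)); exact: WW.
  case: (N x) nW lt => [/(_ Wone) //|n] _ lt.
  by apply: WW => //; exact: lt.
(* Punctured neighbourhoods of 1; the filter is proper because the topology is not discrete. *)
pose F0 : set_system T := fun A => exists U, [/\ tg_open U, U (tg_one T) &
  forall x, U x -> x <> tg_one T -> A x].
have pF0 : ProperFilter F0.
  apply: Build_ProperFilter_ex.
    by move=> A [U [oU U1 UA]]; have [x [Ux nx]] := nd oU U1; exists x; exact: UA.
  split.
  - by exists (fun=> True); split=> //; exact: tg_open_full.
  - move=> A B [U [oU U1 UA]] [V [oV V1 VB]]; exists (fun x => U x /\ V x).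
    by split=> // [|x [Ux Vx] nx]; [exact: tg_open_inter|split; [exact: UA|exact: VB]].
  - by move=> A B AB [U [oU U1 UA]]; exists U; split=> // x Ux nx; apply/AB/UA.
have [F [uF hF]] := ultraFilterLemma pF0.
have pF : ProperFilter F by case: uF.
have FW : F (fun x => W x /\ x <> tg_one T) by apply: hF; exists W.
have lim_ex (p : T -> nat) : (forall x, (p x <= N x)%N) ->
    exists l, ulim F (fun x => tg_pow x (p x)) l.
  move=> pN; apply: ulim_compact cK _; apply: filterS FW => x [Wx nx].
  exact: inK.
have [y hy] := lim_ex N (fun x => leqnn _).
have y1 : y <> tg_one T.
  move=> e; have Wy : W y by rewrite e.
  have [x [[_ nx] Wx]] := filter_ex (filterI FW (hy _ oW Wy)).
  by have [nW _] := hN x nx; exact: nW.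
apply: y1; apply: inj_i; rewrite (ghom1 hi); apply: zs => n.
have [|z hz] := lim_ex (fun x => (N x %/ n`!)%N); first by move=> x; exact: leq_div.
exists (i z); rewrite -(ghomX hi); congr i.
apply: (ulim_uniq pF hT hy).
have h1 : ulim F (fun x => tg_pow (tg_pow x (N x %/ n`!)) n`!) (tg_pow z n`!).
  exact: (ulim_continuous (@tg_continuous_pow T n`!) hz).
(* The remainder exponents are bounded by [n!], so these powers tend to 1 with [x], and [y] is the
   limit of the remaining [n!]-th powers. *)
have h2 : ulim F (fun x => tg_pow x (N x %% n`!)) (tg_one T).
  move=> U oU U1; apply: hF.
  exists (fun x => forall j, (j <= n`!)%N -> U (tg_pow x j)); split.
  - by apply: (tg_open_bigcap (P := fun j x => U (tg_pow x j))) => j _; exact: tg_continuous_pow.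
  - by move=> j _; rewrite tg_pow1.
  - by move=> x hx _; apply: hx; apply: ltnW; rewrite ltn_mod fact_gt0.
have fF : Filter F by case: pF.
have h3 := ulim_mul fF h1 h2; rewrite tg_mulx1 in h3; apply: (ulim_eq fF _ h3).
by apply: filterS filterT => x _; rewrite -tg_powM -tg_powD -divn_eq.
Qed.

End LocallyCompactAbelian.

Lemma cotorsion_free_lcH_slender H : cotorsion_free H -> lcH_slender H.
Proof.
move=> /cotorsion_free_no_compact_image nc G lG hG f hf; apply: contrapT => nk.
have zs : zadic_separated H.
  apply: zadic_separated_of_reduced; first exact: no_compact_image_torsion_free.
  exact: no_compact_image_reduced.
have [O [K [oO [O1 [OK cK]]]]] := lG (tg_one G).
have img0 W : tg_open W -> image_open f (fun h => exists g, W g /\ h = f g).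
  move=> /(image_open_translate hf 0); congr image_open.
  by apply: funextP => h; split=> -[g [Wg e]]; exists g; split=> //; rewrite e ?add0r.
apply: (@no_nondiscrete_lca (image_topgroup hf) H id _ _ _ _ zs nc
  (fun h => exists g, O g /\ h = f g) (fun h => exists g, K g /\ h = f g)) => //.
- exact: addrC.
(* An [h] inseparable from 0 is a value of [f] arbitrarily close to 1, and such values vanish. *)
- apply: hausdorff_of_T1 => h h0.
  have [W [oW [W1 nW]]] : exists W, tg_open W /\ W (tg_one G) /\ ~ exists y, W y /\ f y = h.
    apply: contrapT => /forallNP nex; apply: h0.
    apply: (limit_value_eq0 hG lG hf _ zs nc) => W oW W1.
    by apply: contrapT => nW; apply: (nex W).
  exists (fun h => exists g, W g /\ h = f g); split; first exact: img0.
  split; first by exists (tg_one G); rewrite (ghom1 hf).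
  by move=> [g [Wg e]]; apply: nW; exists g.
- exact: img0.
- by exists (tg_one G); rewrite (ghom1 hf).
- by move=> _ [g [Og ->]]; exists g; split=> //; exact: OK.
- exact: image_compact.
- move=> U oU U1; have [||g [Ug fg]] := ghom_ker_not_open (W := fun g => U (0 + f g)) hf nk.
  + exact: oU.
  + by rewrite (ghom1 hf) addr0.
  by exists (f g); split=> //; rewrite -(add0r (f g)).
Qed.

Theorem theoremC (H : zmodType) :
  (cm_slender H <->
     torsion_free H /\ reduced H /\ no_nondiscrete_polish_subgroup H) /\
  (lcH_slender H <-> cotorsion_free H).
Proof.
split; split.
- move=> sl; split; first exact: cm_slender_torsion_free.
  by split; [exact: cm_slender_reduced|exact: cm_slender_no_polish].
- by move=> [tf [red np]]; exact: cm_slender_sufficient.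
- exact: lcH_slender_cotorsion_free.
- exact: cotorsion_free_lcH_slender.
Qed.
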